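(* Let $X$ be a finite simplicial complex, let $k\geq 1$, and let $A$ be a $k$-th discrete boundary of $X$ (with $X_k\setminus A_k\ne\emptyset$, so that $\mu_k(X,A)$ is defined). Let $$X'=\Big\{\sigma \;\Big|\; \sigma\subseteq\tau \text{ for some } \tau\in (X_k\setminus A_k)\cup\bigcup_{i\ge k+1}X_i\Big\},$$ which is a subcomplex of $X$, and let $h'=h(X')$ and $n'$ be the number of vertices of $X'$. Then $$\mu_k(X,A)\ \ge\ \min_{\sigma\in X'_k}\big((h'+1)\deg_{X'}(\sigma)-|\sigma_{k-1}\cap A_{k-1}|\big)+(h'+1)(k+1)-h'n'$$ $$\ge\ (h'+1)(k+1)-h'n'-\max_{\sigma\in X'_k}|\sigma_{k-1}\cap A_{k-1}|.$$ Moreover, the equality $\mu_k(X,A)=(h'+1)(k+1)-h'n'-\max_{\sigma\in X'_k}|\sigma_{k-1}\cap A_{k-1}|$ holds if and only if $$X'\cong\Big(\Delta^{h'}_{(h'-1)}\Big)^{*(n'-k-1)}*\Delta^{(h'+1)(k+1)-h'n'-1}$$ and $|\sigma_{k-1}\cap A_{k-1}|=c$ (a constant) for all $\sigma\in X'_k$.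
   Context: A simplicial complex $X$ is a finite collection of finite sets closed under taking subsets, always containing $\emptyset$; $\dim\sigma=|\sigma|-1$; $X_k$ is the set of $k$-dimensional faces; $V(X)$ is the union of all faces; $X_{(p)}$ is the subcomplex of faces of dimension at most $p$. For $\sigma\in X_k$: $\deg_X(\sigma)=|\{\eta\in X_{k+1}:\sigma\subseteq\eta\}|$ and $\sigma_{k-1}=\{\tau\in X_{k-1}:\tau\subseteq\sigma\}$. A missing face of $X$ is a set $\sigma\subseteq V(X)$ with $\sigma\notin X$ all of whose proper subsets lie in $X$; $h(X)$ is the maximal dimension of a missing face of $X$ (with $h(X)=0$ if there is none). For $k\le\dim X$, a subcomplex $A\subseteq X$ is a $k$-th discrete boundary of $X$ if $\deg_X(\sigma)\le 1$ for all $\sigma\in A_{k-1}$. $\Delta^m$ is the complete simplicial complex (full simplex) on $m+1$ vertices, with $\Delta^{-1}=\{\emptyset\}$. The join of complexes on disjoint vertex sets is $X*Y=\{\sigma\cup\tau:\sigma\in X,\tau\in Y\}$; $X^{*m}$ is the join of $m$ disjoint copies of $X$, with $X^{*0}=\{\emptyset\}$. $\cong$ denotes simplicial isomorphism (a vertex bijection that is simplicial in both directions). The displayed isomorphism is understood to include $(h'+1)(k+1)-h'n'\ge 0$. Relative Laplacian: fix a total order on $V(X)$. $C_k(X,A;\mathbb{R})=C_k(X;\mathbb{R})/C_k(A;\mathbb{R})$ is identified with the real vector space with basis $X_k\setminus A_k$; for $\sigma=\{v_0\prec\dots\prec v_k\}$, the relative boundary map $\partial_k(X,A;\mathbb{R})$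 sends $[\sigma]$ to $\sum_i(-1)^i[\sigma\setminus\{v_i\}]$, summed over $i$ with $\sigma\setminus\{v_i\}\notin A_{k-1}$. With adjoints (transposes) taken with respect to these bases, $L_k(X,A)=\partial_{k+1}\partial_{k+1}^*+\partial_k^*\partial_k$, a positive semidefinite matrix indexed by $X_k\setminus A_k$, and $\mu_k(X,A)$ is its smallest eigenvalue. *)

(* Defs.v *)
From HB Require Import structures.
From mathcomp Require Import all_boot all_order all_algebra.
From mathcomp Require Import reals.
From mathcomp Require classical_sets.

Set Implicit Arguments.
Unset Strict Implicit.
Unset Printing Implicit Defensive.

Import Order.TTheory GRing.Theory Num.Theory.
Local Open Scope ring_scope.

(* A complex is a family X of subsets of a finite type T of potential vertices;
   elements of T outside [vertices X] are not vertices of X. *)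
Section Complexes.
Variable T : finType.
Implicit Types (X Y A : {set {set T}}) (s t : {set T}) (k : int).

Definition is_complex X : Prop :=
  set0 \in X /\ (forall s t, t \in X -> s \subset t -> s \in X).

Definition subcomplex A X : Prop := is_complex A /\ A \subset X.

Definition vertices X : {set T} := cover X.

(* Dimensions are integers since the empty face has dimension -1. *)
Definition dim s : int := #|s|%:Z - 1.

Definition cdim X : int := (\max_(s in X) #|s|)%:Z - 1.

Definition faces X k : {set {set T}} := [set s in X | dim s == k].

Definition skeleton X k : {set {set T}} := [set s in X | dim s <= k].

Definition deg X s : nat :=
  #|[set t in faces X (dim s + 1) | s \subset t]|.

Definition subfaces X s k : {set {set T}} :=
  [set t in faces X k | t \subset s].

Definition missing_face X s : bool :=
  [&& s \subset vertices X, s \notin X &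
      [forall t : {set T}, (t \proper s) ==> (t \in X)]].

(* A missing face of a complex is nonempty, so #|s|.-1 is its dimension. *)
Definition hdim X : nat := \max_(s : {set T} | missing_face X s) #|s|.-1.

Definition discrete_boundary X A k : Prop :=
  [/\ k <= cdim X, subcomplex A X &
      forall s, s \in faces A (k - 1) -> (deg X s <= 1)%N].

Definition rel_faces X A k : {set {set T}} := faces X k :\: faces A k.

Definition core X A k : {set {set T}} :=
  [set s : {set T} | [exists t : {set T},
     ((t \in rel_faces X A k) || ((t \in X) && (k + 1 <= dim t)))
     && (s \subset t)]].

End Complexes.

Definition vertex (T : finType) (X : {set {set T}}) : Type :=
  {x : T | x \in vertices X}.

Section Isomorphism.
Variables (T U : finType) (X : {set {set T}}) (Y : {set {set U}}).

(* Every subset of [vertices X] is [val @: s] for a unique s. *)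
Definition simplicial (f : vertex X -> vertex Y) : Prop :=
  forall s : {set {x : T | x \in vertices X}},
    val @: s \in X -> [set val (f x) | x in s] \in Y.

End Isomorphism.

Definition isomorphic (T U : finType)
    (X : {set {set T}}) (Y : {set {set U}}) : Prop :=
  exists (f : vertex X -> vertex Y) (g : vertex Y -> vertex X),
    [/\ cancel f g, cancel g f, simplicial f & simplicial g].

(* The full simplex on n vertices, i.e. Delta^(n-1). *)
Definition full_simplex (n : nat) : {set {set 'I_n}} := [set: {set 'I_n}].

(* The sum type makes the two vertex sets disjoint. *)
Definition join (T U : finType) (X : {set {set T}}) (Y : {set {set U}}) :
    {set {set (T + U)%type}} :=
  [set (inl @: s) :|: (inr @: t) | s : {set T} in X, t : {set U} in Y].

(* Copy i of a vertex v is (i, v); a face is a union of faces f i, one in each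
   copy i < m. *)
Definition join_power (T : finType) (X : {set {set T}}) (m : nat) :
    {set {set ('I_m * T)%type}} :=
  [set \bigcup_(i < m) [set (i, v) | v in f i]
     | f : {ffun 'I_m -> {set T}} in ffun_on (mem X)].

(* The least value of F on P, and 0 if P is empty. *)
Definition min_over (I : finType) (P : {set I}) (F : I -> int) : int :=
  if [pick i in P] is Some i0 then F [arg min_(i < i0 in P) F i]%O else 0.

(* The smallest eigenvalue of M in R, and 0 if there is none. *)
Definition smallest_eigenvalue (R : realType) (n : nat) (M : 'M[R]_n) : R :=
  classical_sets.xget 0
    (fun a => eigenvalue M a /\ forall b, eigenvalue M b -> a <= b).

Section RelativeLaplacian.
Variables (R : realType) (d : Order.disp_t) (T : finOrderType d).
Implicit Types (X A P Q : {set {set T}}) (s t : {set T}).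

(* The coefficient of [t] in the sum of (-1)^i [s \ v_i], where
   v_0 < ... < v_k are the elements of s: the exponent i of v_i is the number of
   elements of s below v_i. *)
Definition boundary_coef s t : R :=
  \sum_(v in s | s :\ v == t) (-1) ^+ #|[set u in s | (u < v)%O]|.

(* The matrix, acting on column vectors, of the boundary map from the space with
   basis Q to the space with basis P, dropping the terms outside P. *)
Definition boundary_mx P Q : 'M[R]_(#|P|, #|Q|) :=
  \matrix_(i, j) boundary_coef (enum_val j) (enum_val i).

(* The relative boundary map of index k is
   [boundary_mx (rel_faces X A (k - 1)) (rel_faces X A k)]. *)
Definition rel_laplacian X A (k : int) : 'M[R]_#|rel_faces X A k| :=
  let dn := boundary_mx (rel_faces X A (k - 1)) (rel_faces X A k) in
  let up := boundary_mx (rel_faces X A k) (rel_faces X A (k + 1)) in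
  up *m up^T + dn^T *m dn.

Definition mu X A (k : int) : R := smallest_eigenvalue (rel_laplacian X A k).

End RelativeLaplacian.

(* The default value of [smallest_eigenvalue] is never used by [mu] when
   [rel_faces X A k] is nonempty: see [muP]. *)
From mathcomp Require Import complex polyrcf spectral.

Lemma symmetric_eigenvalue (R : rcfType) n (M : 'M[R]_n) :
  (0 < n)%N -> M^T = M -> exists a, eigenvalue M a.
Proof.
move=> n0 sM; pose B := map_mx (real_complex R) M.
have sB : B \is hermsymmx.
  apply: realsym_hermsym.
    by apply/is_hermitianmxP; rewrite expr0 scale1r map_mx_id // map_trmx sM.
  by apply/mxOverP => i j; rewrite mxE; apply/complex_realP; exists (M i j).
have rB := hermitian_spectral_diag_real sB.
have /orthomx_spectralP := hermitian_normalmx sB.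
move: rB; have := spectral_unit B.
case: n n0 M sM @B {sB} => // n _ M sM B.
set P := spectralmx B; set D := spectral_diag B => uP rD BE.
have /complex_realP[a Da] : D 0 0 \is Num.real by apply/mxOverP.
suff eB : eigenvalue B (D 0 0).
  exists a; rewrite eigenvalue_root_char -(fmorph_root (real_complex R)).
  by rewrite map_char_poly -eigenvalue_root_char /= -/B; rewrite Da in eB.
apply/eigenvalueP; exists (row 0 P).
  rewrite -row_mul BE !mulmxA mulmxV // mul1mx row_mul row_diag_mx.
  by rewrite -scalemxAl -rowE.
apply: contraTneq uP => r0; rewrite -row_free_unit; apply/negP => /row_freeP[Q PQ].
have := congr1 (row 0) PQ; rewrite row_mul r0 mul0mx => /rowP/(_ 0).
by rewrite !mxE eqxx /= => /esym/eqP; rewrite oner_eq0.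
Qed.

Lemma smallest_eigenvalueP (R : realType) n (M : 'M[R]_n) :
  (0 < n)%N -> M^T = M ->
  eigenvalue M (smallest_eigenvalue M) /\
  (forall b, eigenvalue M b -> smallest_eigenvalue M <= b).
Proof.
move=> n0 sM; apply: (@classical_sets.xgetPex _ 0
  (fun a : R => eigenvalue M a /\ forall b, eigenvalue M b -> a <= b)).
have [a Ma] := symmetric_eigenvalue n0 sM.
have p0 : char_poly M != 0 by rewrite monic_neq0 // char_poly_monic.
have rE b : eigenvalue M b = (b \in rootsR (char_poly M)).
  by rewrite eigenvalue_root_char -(roots_on_rootsR p0) in_itv.
have: exists2 x, x \in rootsR (char_poly M) &
        {in rootsR (char_poly M), forall y, x <= y}.
  move: (rootsR _) Ma rE => s Ma rE; rewrite rE in Ma.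
  elim: s a Ma {rE} => // x [|y s] IH a _.
    by exists x => [|z]; rewrite ?inE // => /eqP->.
  have [|z zs zm] := IH y; first by rewrite inE eqxx.
  have [xz|zx] := leP x z.
    exists x; first by rewrite inE eqxx.
    move=> t; rewrite inE => /orP[/eqP-> //|/zm]; exact: le_trans.
  exists z; first by rewrite inE zs orbT.
  by move=> t; rewrite inE => /orP[/eqP->|/zm //]; apply: ltW.
by case=> x xs xm; exists x; split=> [|b]; rewrite rE //; apply: xm.
Qed.

Lemma muP (R : realType) (d : Order.disp_t) (T : finOrderType d)
    (X A : {set {set T}}) (k : int) :
  rel_faces X A k != set0 ->
  eigenvalue (rel_laplacian R X A k) (mu R X A k) /\
  (forall b, eigenvalue (rel_laplacian R X A k) b -> mu R X A k <= b).
Proof.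
move=> ne; apply: smallest_eigenvalueP; first by rewrite card_gt0.
by rewrite /rel_laplacian linearD /= !trmx_mul !trmxK.
Qed.

(* Main.v *)
Require Import Defs.
From HB Require Import structures.
From mathcomp Require Import all_boot all_order all_algebra.
From mathcomp Require Import reals zify ring lra.

Set Implicit Arguments.
Unset Strict Implicit.
Unset Printing Implicit Defensive.

Import Order.TTheory GRing.Theory Num.Theory.
Local Open Scope ring_scope.

(** Write Y for the core, V for its vertices, n for their number and h for the
    largest dimension of a missing face.  A k-face in A lies in no larger face
    of X, since otherwise one of its (k-1)-faces, which are in A, would have
    degree at least 2.  So the k-faces of Y are exactly the basis of the
    relative chains.  For the same reason two distinct basis faces s, t that
    share k vertices never share them in A, and the up and down parts of the
    Laplacian cancel at (s, t) when s together with t spans a face.  What is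
    left is the diagonal deg t + (k + 1) - c t, where c t counts the
    (k-1)-faces of t in A, and an entry 1 or -1 for every face s = t - u + v
    such that t + v is not a face ([laplacian_action]).

    The bound is Gershgorin's.  If t + v is not a face it contains a missing
    face M, and t - u + v can only be a face for u in M - v, so v contributes
    at most h entries ([exch_leq]).  There are n - (k + 1) - deg t such v
    ([blocked_card]), whence the first estimate ([degree_bound]).

    Suppose the eigenvalue is equal to the second bound, and let f be a k-face
    where an eigenfunction has largest absolute value.  No term of the estimate
    is lost at f, and the same then holds at all faces reached from f by
    exchanges ([dominant_tight]).  So each v outside f completes f to a single
    missing face, of dimension h.  These missing faces are disjoint: if two of
    them met in u, the faces f, f - u + v and f - u + w would be pairwise
    related, and the sign rules along this triangle contradict each other
    ([exch_disjoint]).  Exchanging vertices inside these blocks reaches every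
    set of vertices that contains no block ([dominant_cover]); so Y consists of
    exactly these sets, which is to say that it is a join of boundaries of
    simplices with one simplex ([equality_blocks], [blocks_isomorphic]).

    Conversely, such a join has a fundamental cycle with coefficients 1 and -1,
    the product of the boundaries of the blocks, and this cycle is an
    eigenvector for the required value ([block_eigenfunction]). *)

(** * Faces, missing faces and vertex exchanges *)

Section Faces.
Variable T : finType.
Implicit Types (Y : {set {set T}}) (s t M : {set T}).

Lemma in_facesE Y (k : nat) s :
  (s \in faces Y k) = (s \in Y) && (#|s| == k.+1).
Proof. by rewrite inE /Defs.dim; congr (_ && _); apply/eqP/eqP; lia. Qed.

Lemma in_faces_predE Y (k : nat) s :
  (s \in faces Y (k%:Z - 1)) = (s \in Y) && (#|s| == k).
Proof. by rewrite inE /Defs.dim; congr (_ && _); apply/eqP/eqP; lia. Qed.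

Lemma in_faces_succE Y (k : nat) s :
  (s \in faces Y (k%:Z + 1)) = (s \in Y) && (#|s| == k.+2).
Proof. by rewrite inE /Defs.dim; congr (_ && _); apply/eqP/eqP; lia. Qed.

Lemma sub_vertices Y s : s \in Y -> s \subset vertices Y.
Proof. by move=> sY; apply: bigcup_sup. Qed.

Lemma vertex_face Y x : is_complex Y -> x \in vertices Y -> [set x] \in Y.
Proof.
by case=> _ dY /bigcupP[s sY xs]; apply: (dY _ s); rewrite ?sub1set.
Qed.

Lemma missing_face_leq Y M : missing_face Y M -> (#|M| <= (hdim Y).+1)%N.
Proof.
move=> mM; suff: (#|M|.-1 <= hdim Y)%N by lia.
exact: (@bigop.leq_bigmax_cond _ (missing_face Y) (fun s : {set T} => #|s|.-1) M mM).
Qed.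

Lemma nonface_missing Y s : s \subset vertices Y -> s \notin Y ->
  exists2 M : {set T}, missing_face Y M & M \subset s.
Proof.
move=> sV sY.
have [|M /minsetP[/andP[Ms MY] minM] _] :=
  @minset_exists T (fun M => (M \subset s) && (M \notin Y)) s; rewrite ?subxx //.
exists M => //; apply/and3P; split=> //; first exact: subset_trans sV.
apply/forallP => t; apply/implyP => /properP[tM [x xM xt]].
by apply: contraNT xt => tY; rewrite (minM t) // tY (subset_trans tM).
Qed.

Lemma cardsU1D1 t u v : u \in t -> v \notin t -> #|v |: (t :\ u)| = #|t|.
Proof.
move=> ut vt; rewrite cardsU1 !inE (negPf vt) andbF (cardsD1 u t) ut //.
Qed.

Definition exch Y t v : {set T} := [set u in t | v |: (t :\ u) \in Y].

Lemma exchP Y t u v : reflect (u \in t /\ v |: (t :\ u) \in Y) (u \in exch Y t v).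
Proof. by rewrite inE; apply: andP. Qed.

(** An exchange has to destroy each missing face that adding [v] creates, and
    cannot do so by removing [v] itself. *)
Lemma exch_subD1 Y t v M : is_complex Y -> M \subset v |: t -> M \notin Y ->
  exch Y t v \subset M :\ v.
Proof.
move=> [_ dY] Mvt MY; apply/subsetP => u /exchP[ut uY].
apply: contraR MY; rewrite !inE negb_and negbK => /orP[/eqP uv|uM].
  apply: dY uY _; apply: subset_trans Mvt _.
  by rewrite -uv subUset subsetUl /= (setD1K ut).
apply: dY uY _; apply/subsetP => x xM; have := subsetP Mvt x xM.
by rewrite !inE; case: eqP => //= _ ->; rewrite andbT; apply: contraNneq uM => <-.
Qed.

Lemma nonface_mem Y t v M : is_complex Y -> t \in Y ->
  M \subset v |: t -> M \notin Y -> v \in M.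
Proof.
move=> [_ dY] tY Mvt; apply: contraR => vM; apply: dY tY _.
apply/subsetP => x xM; have := subsetP Mvt x xM; rewrite !inE => /orP[/eqP xv|//].
by rewrite -xv xM in vM.
Qed.

(** A missing face in [v |: t] contains [v], which leaves at most [hdim Y] of
    its vertices to be removed. *)
Lemma exch_leq Y t v : is_complex Y -> t \in Y -> v \in vertices Y ->
  v |: t \notin Y -> (#|exch Y t v| <= hdim Y)%N.
Proof.
move=> cY tY vV vtY.
have [|M mM Mvt] := nonface_missing _ vtY.
  by rewrite subUset sub1set vV sub_vertices.
have /and3P[_ MY _] := mM.
have := subset_leq_card (exch_subD1 cY Mvt MY); have := missing_face_leq mM.
by rewrite (cardsD1 v M) (nonface_mem cY tY Mvt MY); lia.
Qed.

(** With the largest possible number of exchanges, the bound of [exch_leq]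
    leaves no room for a second missing face. *)
Lemma exch_missing Y t v M : is_complex Y -> t \in Y -> missing_face Y M ->
  M \subset v |: t -> #|exch Y t v| = hdim Y -> M = v |: exch Y t v.
Proof.
move=> cY tY mM Mvt cE; have /and3P[_ MY _] := mM.
have vM := nonface_mem cY tY Mvt MY.
rewrite -(setD1K vM); congr (_ |: _); apply/esym/eqP.
rewrite eqEcard exch_subD1 //= cE.
by have := missing_face_leq mM; rewrite (cardsD1 v M) vM; lia.
Qed.

Lemma degE Y t : is_complex Y -> t \in Y ->
  deg Y t = #|[set v in vertices Y :\: t | v |: t \in Y]|.
Proof.
move=> cY tY; pose Q := [set v in vertices Y :\: t | v |: t \in Y].
rewrite -/Q /deg -(@card_in_imset _ _ (fun v => v |: t) Q); last first.
  move=> v w; rewrite !inE => /andP[/andP[vt _] _] _ /setP/(_ v).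
  by rewrite !inE eqxx /= (negPf vt) orbF => /esym/eqP.
congr #|pred_of_set _|; apply/setP => s; apply/idP/imsetP.
  rewrite inE /Defs.dim subrK inE => /andP[/andP[sY /eqP cs]] ts.
  have /cards1P[v vE] : #|s :\: t| == 1%N.
    by rewrite cardsDS // eqn_leq; move: cs; rewrite /Defs.dim; lia.
  have sE : s = v |: t by rewrite -vE setUC -{1}(setIidPr ts) setID.
  have vs : v \in s :\: t by rewrite vE inE.
  exists v => //; rewrite inE -sE sY andbT.
  by move: vs; rewrite !inE => /andP[-> /(subsetP (sub_vertices sY))->].
case=> v; rewrite !inE => /andP[/andP[vt _] vY] ->.
by rewrite vY subsetUr /Defs.dim cardsU1 vt andbT; apply/eqP; lia.
Qed.

Lemma card_codim Y (k : nat) t : t \in faces Y k ->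
  (#|vertices Y :\: t| + k.+1 = #|vertices Y|)%N.
Proof.
rewrite in_facesE => /andP[tY /eqP tk]; have tV := sub_vertices tY.
by have := subset_leq_card tV; rewrite cardsDS // tk; lia.
Qed.

End Faces.

(** * Incidence signs *)

Section Signs.
Variables (R : realType) (d : Order.disp_t) (T : finOrderType d).
Implicit Types (Y X A : {set {set T}}) (s t r : {set T}).

Local Notation bc := (boundary_coef R).

Definition ltsign (x y : T) : R := (-1) ^+ (x < y)%O.

Lemma ltsign_sqr x y : ltsign x y * ltsign x y = 1.
Proof. by rewrite /ltsign -expr2 sqrr_sign. Qed.

Lemma ltsignC x y : x != y -> ltsign x y * ltsign y x = -1.
Proof.
by move=> xy; rewrite /ltsign; case: ltgtP xy => //= *; rewrite ?expr0 ?expr1; ring.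
Qed.

Lemma boundary_coefU1 r v : v \notin r ->
  bc (v |: r) r = \prod_(u in r) ltsign u v.
Proof.
move=> vr; rewrite /boundary_coef (big_pred1 v) => [|w /=]; last first.
  rewrite !inE; case: eqP => [->|wv] /=; first by rewrite setU1K ?eqxx.
  apply/negP => /andP[wr /eqP/setP/(_ w)]; by rewrite !inE eqxx wr.
rewrite prodrXr -sum1_card; congr (_ ^+ _).
rewrite [RHS](eq_bigr (fun u => if (u < v)%O then 1%N else 0%N));
  last by move=> u _; case: ifP.
rewrite -big_mkcondr; apply: eq_bigl => u; rewrite !inE.
by case: eqP => [->|//]; rewrite ltxx (negPf vr).
Qed.

Lemma boundary_coef_sqr r v : v \notin r -> bc (v |: r) r * bc (v |: r) r = 1.
Proof.
by move=> vr; rewrite boundary_coefU1 // -big_split big1 // => u _; apply: ltsign_sqr.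
Qed.

Lemma boundary_coef_neq0 s r : bc s r != 0 -> exists2 v, v \notin r & s = v |: r.
Proof.
rewrite /boundary_coef; have [v /andP[vs /eqP vr] _|no] :=
  pickP [pred v in s | s :\ v == r].
  by exists v; rewrite -vr ?setD1K // !inE eqxx.
by rewrite big_pred0 ?eqxx.
Qed.

Lemma boundary_coef0 s r : ~~ (r \subset s) -> bc s r = 0.
Proof.
by move=> rs; apply: contraNeq rs => /boundary_coef_neq0[v _ ->]; rewrite subsetUr.
Qed.

(** The relation that makes the boundary of a boundary vanish, with the two
    coefficients out of the top face on the left.  It is what cancels the up
    and down parts of the Laplacian. *)
Lemma boundary_coef_square r u v : u \notin r -> v \notin r -> u != v ->
  bc (v |: (u |: r)) (u |: r) * bc (u |: (v |: r)) (v |: r) =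
  - (bc (u |: r) r * bc (v |: r) r).
Proof.
move=> ur vr uv; rewrite !boundary_coefU1 ?inE ?negb_or ?ur ?vr ?andbT //;
  last by rewrite eq_sym.
rewrite !big_setU1 //=; have := ltsignC uv.
set a := ltsign u v; set b := ltsign v u => ab.
set x := \prod_(_ in _) _; set y := \prod_(_ in _) _.
by rewrite mulrACA ab mulN1r mulrC.
Qed.

(** The entry of the down Laplacian at [t] and [v |: (t :\ u)]. *)
Definition exchange_sign t u v : R :=
  bc t (t :\ u) * bc (v |: (t :\ u)) (t :\ u).

Lemma exchange_sign_sqr t u v : u \in t -> v \notin t ->
  exchange_sign t u v * exchange_sign t u v = 1.
Proof.
move=> ut vt; rewrite /exchange_sign mulrACA.
rewrite -{1 3}(setD1K ut) !boundary_coef_sqr ?mulr1 // ?inE ?eqxx //.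
by rewrite negb_and vt orbT.
Qed.

Lemma exchange_signE t u v : u \in t -> v \notin t ->
  exchange_sign t u v = \prod_(x in t :\ u) (ltsign x u * ltsign x v).
Proof.
move=> ut vt; rewrite /exchange_sign -{1}(setD1K ut).
rewrite !boundary_coefU1 ?inE ?eqxx ?(negPf vt) ?andbF //.
by rewrite big_split.
Qed.

End Signs.

(** * The Gershgorin estimate *)

Section Eigenfunctions.
Variables (R : realType) (d : Order.disp_t) (T : finOrderType d).
Variables (Y : {set {set T}}) (k : nat) (c : {set T} -> nat).
Hypothesis cY : is_complex Y.
Implicit Types (s t : {set T}) (phi : {set T} -> R) (a : R).

Local Notation V := (vertices Y).
Local Notation h := (hdim Y).

(** The vertices that contribute to row [t] of the Laplacian off the diagonal. *)
Definition blocked t : {set T} := [set v in V :\: t | v |: t \notin Y].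

Definition exchange_sum phi t : R :=
  \sum_(v in blocked t) \sum_(u in exch Y t v)
    exchange_sign R t u v * phi (v |: (t :\ u)).

(** The eigenvalue equation of the relative Laplacian: [X] and [A] enter it only
    through the core [Y] and the numbers [c]; see [laplacian_action]. *)
Definition eigenfunction phi a : Prop := forall t, t \in faces Y k ->
  ((deg Y t)%:R + k.+1%:R - (c t)%:R) * phi t + exchange_sum phi t = a * phi t.

Lemma blocked_card t : t \in faces Y k ->
  (k.+1 + deg Y t + #|blocked t|)%N = #|V|.
Proof.
rewrite in_facesE => /andP[tY /eqP tk]; rewrite degE // -tk.
rewrite -(cardsID t V) (setIidPr (sub_vertices tY)) -addnA; congr addn.
rewrite -(cardsID [set v | v |: t \in Y] (V :\: t)); congr (_ + _)%N.
  by apply: eq_card => v; rewrite !inE.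
by apply: eq_card => v; rewrite !inE andbC.
Qed.

Lemma exch_face t v u : t \in faces Y k -> v \notin t -> u \in exch Y t v ->
  v |: (t :\ u) \in faces Y k.
Proof.
rewrite !in_facesE => /andP[_ /eqP tk] vt /exchP[ut ->].
by rewrite cardsU1D1 // tk /=.
Qed.

Lemma exch_total_leq t : t \in faces Y k ->
  (\sum_(v in blocked t) #|exch Y t v| <= h * #|blocked t|)%N.
Proof.
rewrite in_facesE => /andP[tY _]; rewrite mulnC -sum_nat_const.
apply: leq_sum => v; rewrite !inE => /andP[/andP[_ vV] vtY].
exact: exch_leq.
Qed.

(** Gershgorin's inequality with its error term made explicit, so that the
    case of equality can be read off: where [phi] is dominant, each summand on
    the right is nonnegative. *)
Lemma eigenfunction_defect phi a t : eigenfunction phi a -> t \in faces Y k ->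
  (a - ((deg Y t)%:R + k.+1%:R - (c t)%:R
        - (\sum_(v in blocked t) #|exch Y t v|)%:R)) * phi t ^+ 2 =
  \sum_(v in blocked t) \sum_(u in exch Y t v)
    (phi t ^+ 2 + exchange_sign R t u v * phi (v |: (t :\ u)) * phi t).
Proof.
move=> /[apply] e.
transitivity ((\sum_(v in blocked t) #|exch Y t v|)%:R * phi t ^+ 2
  + exchange_sum phi t * phi t).
  move: e; set S := exchange_sum _ _; set E := _%:R; set D := _ - _ => e.
  rewrite opprB addrCA mulrDl; congr (_ + _).
  by rewrite expr2 mulrA mulrBl -e; ring.
rewrite natr_sum mulr_suml /exchange_sum mulr_suml -big_split /=.
apply: eq_bigr => v _; rewrite mulr_suml big_split /=; congr (_ + _).
by rewrite sumr_const mulr_natl.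
Qed.

Definition dominant phi t := t \in faces Y k /\
  forall s, s \in faces Y k -> `|phi s| <= `|phi t|.

Lemma exchange_defect_ge0 phi t v u : dominant phi t -> v \in blocked t ->
  u \in exch Y t v ->
  0 <= phi t ^+ 2 + exchange_sign R t u v * phi (v |: (t :\ u)) * phi t.
Proof.
move=> [tP tmax] /setIdP[/setDP[_ vt] _] uE.
have le := tmax _ (exch_face tP vt uE); have /exchP[ut _] := uE.
have := exchange_sign_sqr R ut vt; move: (exchange_sign _ _ _ _) => e ee.
have e1 : `|e| = 1.
  by move/eqP: ee; rewrite -expr2 sqrf_eq1 => /orP[]/eqP->; rewrite ?normrN normr1.
rewrite addrC -lerBlDr sub0r; apply: lerNnormlW; rewrite !normrM e1 mul1r.
by rewrite -real_normK ?num_real // expr2 ler_wpM2r.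
Qed.

End Eigenfunctions.

Lemma min_over_leq (I : finType) (P : {set I}) (F : I -> int) i :
  i \in P -> min_over P F <= F i.
Proof.
rewrite /min_over => iP; case: pickP => [i0 i0P|/(_ i)]; last by rewrite iP.
by case: arg_minP => // j _; apply.
Qed.

Lemma min_over_attained (I : finType) (P : {set I}) (F : I -> int) i :
  i \in P -> exists2 j, j \in P & min_over P F = F j.
Proof.
rewrite /min_over => iP; case: pickP => [i0 i0P|/(_ i)]; last by rewrite iP.
by case: arg_minP => // j jP _; exists j.
Qed.

Section Gershgorin.
Variables (R : realType) (d : Order.disp_t) (T : finOrderType d).
Variables (Y : {set {set T}}) (k : nat) (c : {set T} -> nat).
Hypothesis cY : is_complex Y.
Implicit Types (s t : {set T}) (phi : {set T} -> R) (a : R).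

Local Notation V := (vertices Y).
Local Notation h := (hdim Y).
Local Notation b := ((h.+1 * k.+1)%:Z - (h * #|V|)%:Z).

Lemma exists_dominant phi s : s \in faces Y k -> phi s != 0 ->
  exists2 t, dominant Y k phi t & phi t != 0.
Proof.
move=> sP s0.
have [t tP tmax] := arg_maxP (fun t => `|phi t|) sP.
exists t => //; apply: contraNneq s0 => t0.
by rewrite -normr_le0 (le_trans (tmax _ sP)) //= t0 normr0.
Qed.

(** The left side is the left end of the Gershgorin disc of the row of [t]. *)
Lemma disc_bound phi a t : eigenfunction Y k c phi a -> dominant Y k phi t ->
  phi t != 0 ->
  (deg Y t)%:R + k.+1%:R - (c t)%:R
    - (\sum_(v in blocked Y t) #|exch Y t v|)%:R <= a.
Proof.
move=> ev dt t0; have [tP _] := dt.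
have := eigenfunction_defect ev tP.
set D := _ + _ - _ - _; move=> E.
have tt : 0 < phi t ^+ 2 by rewrite exprn_even_gt0.
rewrite -subr_ge0 -(pmulr_lge0 _ tt) E.
apply: sumr_ge0 => v vB; apply: sumr_ge0 => u uE.
exact: (exchange_defect_ge0 dt vB uE).
Qed.

(** Replace the number of entries in row [t] by [h] for each blocked vertex. *)
Lemma degree_bound phi a t : eigenfunction Y k c phi a -> dominant Y k phi t ->
  phi t != 0 -> ((h.+1 * deg Y t)%:Z - (c t)%:Z + b)%:~R <= a.
Proof.
move=> ev dt t0; apply: le_trans (disc_bound ev dt t0).
have [tP _] := dt; have tot := exch_total_leq cY tP.
have bc := blocked_card cY tP.
rewrite -!natrD !pmulrn -!intrB ler_int; nia.
Qed.

(** The combinatorial part of equality in the estimate at [t]. *)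
Definition tight t : Prop :=
  forall v, v \in V :\: t -> v |: t \notin Y /\ #|exch Y t v| = h.

(** Equality propagates: it forces [phi] to have the same absolute value at
    all faces obtained from [t] by exchanges, so that these are again dominant,
    and it determines the sign of [phi] there. *)
Lemma dominant_tight phi a cm t : eigenfunction Y k c phi a ->
  dominant Y k phi t -> phi t != 0 ->
  (forall s, s \in faces Y k -> c s <= cm)%N -> a = (b - cm%:Z)%:~R ->
  [/\ tight t, c t = cm &
      forall v u, v \in V :\: t -> u \in exch Y t v ->
        dominant Y k phi (v |: (t :\ u)) /\
        phi t = - (exchange_sign R t u v * phi (v |: (t :\ u)))].
Proof.
move=> ev dt t0 cmax aE; have [tP tmax] := dt; have tot := exch_total_leq cY tP.
have bc := blocked_card cY tP; have ccm := cmax _ tP.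
have := disc_bound ev dt t0; have := eigenfunction_defect ev tP.
set N := (\sum_(v in blocked Y t) _)%N in tot *.
rewrite aE -!natrD !pmulrn -!intrB ler_int => E le.
have [deg0 cE NE] : [/\ deg Y t = 0%N, c t = cm & N = (h * #|blocked Y t|)%N].
  by split; nia.
have tBE : blocked Y t = V :\: t.
  apply/eqP; rewrite eqEcard; apply/andP; split.
    by apply/subsetP => v /setIdP[].
  have tY : t \subset V by case/setIdP: tP => /sub_vertices.
  rewrite cardsDS //; move: tP; rewrite in_facesE => /andP[_ /eqP->]; lia.
have exE v : v \in blocked Y t -> #|exch Y t v| = h.
  move=> vB; have : N == (\sum_(v in blocked Y t) h)%N.
    by rewrite sum_nat_const mulnC NE.
  have [|_ ->] := @leqif_sum _ (mem (blocked Y t)) (fun v => #|exch Y t v| == h)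
     (fun v => #|exch Y t v|) (fun=> h).
    move=> w; rewrite !inE => /andP[/andP[_ wV] wtY]; split=> //.
    by apply: exch_leq => //; case/setIdP: tP.
  by move/forall_inP/(_ v vB)/eqP.
split=> // [v|v u].
  by rewrite -tBE => vB; split; [case/setIdP: vB | apply: exE].
rewrite -tBE => vB uE.
have vt : v \notin t by case/setIdP: vB => /setDP[].
have sP := exch_face tP vt uE.
have zE : phi t ^+ 2 + exchange_sign R t u v * phi (v |: (t :\ u)) * phi t = 0.
  move: E; rewrite [X in X * _ = _](_ : _ = 0); last first.
    by apply/eqP; rewrite intr_eq0; apply/eqP; nia.
  rewrite mul0r => /esym /psumr_eq0P; move=> /(_ _ v vB) H.
  have ge0 w x : w \in blocked Y t -> x \in exch Y t w ->
     0 <= phi t ^+ 2 + exchange_sign R t x w * phi (w |: (t :\ x)) * phi t.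
    exact: exchange_defect_ge0 dt.
  have /psumr_eq0P : \sum_(u in exch Y t v)
    (phi t ^+ 2 + exchange_sign R t u v * phi (v |: (t :\ u)) * phi t) = 0.
    by apply: H => w wB; apply: sumr_ge0 => x; apply: ge0.
  by move=> /(_ _ u uE); apply=> x; apply: ge0.
have tE : phi t = - (exchange_sign R t u v * phi (v |: (t :\ u))).
  by apply: (mulIf t0); apply/eqP; rewrite mulNr -addr_eq0 -expr2 zE.
split=> //; split=> // s /tmax /le_trans; apply.
rewrite tE normrN normrM -[leRHS]mul1r ler_wpM2r //.
have /exchP[ut _] := uE.
have /eqP := exchange_sign_sqr R ut vt; rewrite -expr2 sqrf_eq1.
by case/orP => /eqP->; rewrite ?normrN normr1.
Qed.

End Gershgorin.

(** * Equality forces a partition into missing faces *)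

Section Blocks.
Variable T : finType.
Implicit Types (V s t M : {set T}) (Y B : {set {set T}}).

(** Combinatorial form of being a join of [#|B|] boundaries of [h]-simplices
    with a full simplex: the missing faces are disjoint, all of size [h.+1],
    and the facets, which omit one vertex of each, have [k.+1] vertices. *)
Definition block_structure Y B (h k : nat) : Prop :=
  [/\ trivIset B,
      forall M, M \in B -> #|M| = h.+1 /\ M \subset vertices Y,
      (#|B| + k.+1)%N = #|vertices Y| &
      forall s, s \subset vertices Y ->
        (s \in Y) = [forall M in B, ~~ (M \subset s)]].

Lemma trivIset_eq B M N x :
  trivIset B -> M \in B -> N \in B -> x \in M -> x \in N -> M = N.
Proof.
by move=> tB MB NB xM xN; rewrite -(def_pblock tB MB xM) (def_pblock tB NB xN).
Qed.

(** The complement of [t] meets each of the disjoint blocks, and has only as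
    many elements as there are blocks. *)
Lemma block_facet V B t w : trivIset B ->
  (forall M, M \in B -> M \subset V /\ ~~ (M \subset t)) ->
  #|V :\: t| = #|B| -> w \in V :\: t ->
  exists2 M : {set T}, M \in B & M :\: t = [set w].
Proof.
move=> tB BV cVt wVt; pose p M := odflt w [pick x in M :\: t].
have pP M : M \in B -> p M \in M :\: t.
  move=> MB; rewrite /p; case: pickP => //= no; have [_] := BV _ MB.
  by case/subsetPn => x xM xt; have := no x; rewrite !inE xM xt.
have pV : p @: B = V :\: t.
  apply/eqP; rewrite eqEcard; apply/andP; split.
    apply/subsetP => _ /imsetP[M MB ->]; have := pP _ MB.
    by rewrite !inE => /andP[-> /(subsetP (proj1 (BV _ MB)))].
  rewrite card_in_imset ?cVt // => M N MB NB e.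
  have /setDP[mM _] := pP _ MB; have /setDP[mN _] := pP _ NB.
  by apply: (trivIset_eq tB MB NB mM); rewrite e.
move: (wVt); rewrite -pV => /imsetP[M MB wM]; exists M => //.
apply/eqP; rewrite eqEsubset sub1set {2}wM pP // andbT.
apply/subsetP => x /setDP[xM xt]; rewrite inE.
have : x \in V :\: t by rewrite !inE xt (subsetP (proj1 (BV _ MB))).
rewrite -pV => /imsetP[N NB xN]; have /setDP[] := pP _ NB; rewrite -xN => xN' _.
by rewrite xN wM (trivIset_eq tB MB NB xM xN').
Qed.

End Blocks.

Section Equality.
Variables (R : realType) (d : Order.disp_t) (T : finOrderType d).
Variables (Y : {set {set T}}) (k : nat) (c : {set T} -> nat).
Hypothesis cY : is_complex Y.
Variables (phi : {set T} -> R) (a : R) (cm : nat) (f0 : {set T}).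
Local Notation V := (vertices Y).
Local Notation h := (hdim Y).
Local Notation b := ((h.+1 * k.+1)%:Z - (h * #|V|)%:Z).
Hypothesis ev : eigenfunction Y k c phi a.
Hypothesis cmax : forall s, s \in faces Y k -> (c s <= cm)%N.
Hypothesis aE : a = (b - cm%:Z)%:~R.
Hypothesis df0 : dominant Y k phi f0.
Hypothesis f0_neq0 : phi f0 != 0.
Implicit Types (s t M : {set T}).

Let dominantP t : dominant Y k phi t ->
  [/\ tight Y t, c t = cm &
      forall v u, v \in V :\: t -> u \in exch Y t v ->
        dominant Y k phi (v |: (t :\ u)) /\
        phi t = - (exchange_sign R t u v * phi (v |: (t :\ u)))].
Proof.
move=> dt; apply: (dominant_tight cY ev dt _ cmax aE).
apply: contraNneq f0_neq0 => t0.
by rewrite -normr_le0 -(normr0 R) -t0 (proj2 dt) ?(proj1 df0).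
Qed.

Let f0Y : f0 \in Y.
Proof. by have [+ _] := df0 => /setIdP[]. Qed.

(** For dominant [f0] this is the only missing face of [Y] in [v |: f0]. *)
Definition block v := v |: exch Y f0 v.

Lemma block_missing v : v \in V :\: f0 -> missing_face Y (block v).
Proof.
move=> vV; have [/(_ v vV)[vY ce] _ _] := dominantP df0.
have [|M mM Mv] := nonface_missing _ vY.
  by rewrite subUset sub1set sub_vertices // andbT; case/setDP: vV.
by rewrite /block -(exch_missing cY f0Y mM Mv ce).
Qed.

Lemma card_block v : v \in V :\: f0 -> #|block v| = h.+1.
Proof.
move=> vV; have [/(_ v vV)[_ ce] _ _] := dominantP df0.
rewrite cardsU1 ce; case: (boolP (_ \in _)) => // /exchP[vf0 _].
by case/setDP: vV; rewrite vf0.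
Qed.

Lemma dominant_swap t v M : dominant Y k phi t -> v \in V :\: t ->
  missing_face Y M -> M \subset v |: t -> M = v |: exch Y t v.
Proof.
move=> dt vV mM Mv; have [/(_ v vV)[_ ce] _ _] := dominantP dt.
by apply: exch_missing => //; have [/setIdP[]] := dt.
Qed.

(** If [u] could be exchanged for both [v] and [w], then [f0] and the two faces
    [v |: (f0 :\ u)], [w |: (f0 :\ u)] would be pairwise related by exchanges
    through the common face [f0 :\ u].  Each of the three relations asks [phi]
    for the opposite of the sign that incidence with [f0 :\ u] prescribes; the
    product of the three is impossible. *)
Lemma exch_disjoint u v w : v \in V :\: f0 -> w \in V :\: f0 ->
  u \in exch Y f0 v -> u \in exch Y f0 w -> v = w.
Proof.
move=> vV wV uv uw; apply/eqP; apply: contraT => vw.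
have [_ _ /[dup] /(_ _ _ vV uv)[dv ev1] /(_ _ _ wV uw)[_ ew1]] := dominantP df0.
have /exchP[uf0 _] := uv; have [_ vf0] := setDP vV; have [wV' wf0] := setDP wV.
have vr : v \notin f0 :\ u by rewrite !inE negb_and vf0 orbT.
have wr : w \notin f0 :\ u by rewrite !inE negb_and wf0 orbT.
have ur : u \notin f0 :\ u by rewrite !inE eqxx.
have wv : w \in V :\: (v |: (f0 :\ u)).
  by rewrite !inE (negPf wf0) wV' andbF orbF eq_sym vw.
have vw2 : v \in exch Y (v |: (f0 :\ u)) w.
  by apply/exchP; rewrite setU1K // setU11; have /exchP[] := uw.
have [_ _ /(_ _ _ wv vw2)[_]] := dominantP dv.
rewrite setU1K // => evw; move: f0_neq0; rewrite ev1 evw.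
have := ew1; rewrite ev1 evw /exchange_sign setU1K //.
have := boundary_coef_sqr R vr; have := boundary_coef_sqr R wr.
have := boundary_coef_sqr R ur; rewrite (setD1K uf0).
move: (boundary_coef _ _ _) (boundary_coef _ _ _) (boundary_coef _ _ _) => x y z.
move: (phi _) => p xx yy zz.
(* The three sign rules contradict each other unless phi vanishes at the third
   face, where its value is p. *)
rewrite mulrN opprK (_ : z * x * (x * y * p) = z * (x * x) * y * p); last by ring.
rewrite zz mulr1 => E; suff -> : z * y * p = 0 by rewrite eqxx.
lra.
Qed.

Lemma block_inj v w : v \in V :\: f0 -> w \in V :\: f0 ->
  ~~ [disjoint block v & block w] -> v = w.
Proof.
move=> vV wV /pred0Pn[x /=].
have [_ vf0] := setDP vV; have [_ wf0] := setDP wV.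
case/andP => /setU1P[xv|xv] /setU1P[xw|xw].
- by rewrite -xv.
- by case/exchP: xw; rewrite xv (negPf vf0).
- by case/exchP: xv; rewrite xw (negPf wf0).
exact: exch_disjoint xv xw.
Qed.

Definition blocks := block @: (V :\: f0).

Lemma blocks_trivIset : trivIset blocks.
Proof.
apply/trivIsetP => _ _ /imsetP[v vV ->] /imsetP[w wV ->].
by apply: contraR => /(block_inj vV wV) ->.
Qed.

Lemma card_blocks : #|blocks| = #|V :\: f0|.
Proof.
apply: card_in_imset => v w vV wV E; apply: block_inj => //.
by apply/pred0Pn; exists v; rewrite /= -E setU11.
Qed.

Lemma blocks_missing M : M \in blocks -> missing_face Y M.
Proof. by case/imsetP => v vV ->; apply: block_missing. Qed.

(** Among the dominant faces, walk towards [s]: if [w] is in [s] but not in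
    [t], the block completed by [w] is not inside [s], so one of its vertices
    outside [s] can be exchanged for [w]. *)
Lemma dominant_cover s : s \subset V ->
  (forall M, M \in blocks -> ~~ (M \subset s)) ->
  exists2 t, dominant Y k phi t & s \subset t.
Proof.
move=> sV sB.
suff: forall n t, dominant Y k phi t -> #|s :\: t| = n ->
   exists2 t, dominant Y k phi t & s \subset t by move/(_ _ f0 df0 erefl).
elim=> [|n IHn] t dt; first by move/eqP; rewrite cards_eq0 setD_eq0; exists t.
move=> st; have /card_gt0P[w /setDP[ws wt]] : (0 < #|s :\: t|)%N by rewrite st.
have [tP _] := dt; have /setIdP[tY _] := tP; have [_ dY] := cY.
have wVt : w \in V :\: t by rewrite inE wt (subsetP sV).
have [||M MB Mw] := @block_facet _ V blocks t w blocks_trivIset _ _ wVt.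
- move=> M /blocks_missing/and3P[MV MY _]; split=> //.
  by apply: contra MY; apply: dY.
- by rewrite card_blocks; have := card_codim tP; have := card_codim (proj1 df0); lia.
have Mwt : M \subset w |: t.
  by apply/subsetP => x xM; rewrite -Mw !inE xM andbT orNb.
have ME := dominant_swap dt wVt (blocks_missing MB) Mwt.
have /subsetPn[u uM us] := sB _ MB.
have uE : u \in exch Y t w.
  by move: uM; rewrite ME => /setU1P[uw|//]; rewrite uw ws in us.
have [_ _ /(_ _ _ wVt uE)[ds _]] := dominantP dt.
apply: IHn ds _; apply: succn_inj; rewrite -st (cardsD1 w (s :\: t)).
rewrite inE wt ws add1n; congr _.+1; apply: eq_card => x; rewrite !inE.
case: (eqVneq x w) => //= xw; by case: (eqVneq x u) => //= ->; rewrite (negPf us) !andbF.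
Qed.

Lemma equality_blocks :
  block_structure Y blocks h k /\ (forall s, s \in faces Y k -> c s = cm).
Proof.
have nB s M : s \in Y -> M \in blocks -> ~~ (M \subset s).
  move=> sY /blocks_missing/and3P[_ MY _]; apply: contra MY => Ms.
  by case: cY => _ /(_ _ _ sY Ms).
split; last first.
  move=> s /[dup] sP; rewrite in_facesE => /andP[sY /eqP sk].
  have [t dt st] := dominant_cover (sub_vertices sY) (fun M => nB s M sY).
  suff -> : s = t by have [] := dominantP dt.
  apply/eqP; rewrite eqEcard st sk.
  by have [+ _] := dt; rewrite in_facesE => /andP[_ /eqP->]; rewrite leqnn.
split; first exact: blocks_trivIset.
- move=> M /[dup] /blocks_missing/and3P[MV _ _] /imsetP[v vV ->].
  by rewrite card_block //; split=> //; have /and3P[] := block_missing vV.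
- by rewrite card_blocks card_codim // (proj1 df0).
move=> s sV; apply/idP/forall_inP => [sY M|sB]; first exact: nB.
have [t [/setIdP[tY _] _] st] := dominant_cover sV sB.
by case: cY => _ /(_ _ _ tY st).
Qed.

End Equality.

(** * The extremal cycle of a join of simplex boundaries *)

Section Cycle.
Variables (R : realType) (d : Order.disp_t) (T : finOrderType d).
Implicit Types (V C s t M : {set T}) (Y B : {set {set T}}).

Local Notation lts := (ltsign R).

Lemma prod_sqr1 (I : finType) (P : pred I) (F : I -> R) :
  (forall i, P i -> F i * F i = 1) ->
  (\prod_(i | P i) F i) * (\prod_(i | P i) F i) = 1.
Proof. by move=> F1; rewrite -big_split big1. Qed.

Section BlockSign.
Variable blk : T -> nat.

Definition pair_sign x y : R := if (blk y < blk x)%N then lts y x else 1.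

Definition cross_sign C : R := \prod_(x in C) \prod_(y in C) pair_sign x y.

(** Up to a sign that does not depend on [t], the coefficient of the facet [t] in
    the product of the boundaries of the blocks with the remaining simplex: the
    sign of the permutation of [V] that lists the omitted vertices [V :\: t],
    block by block, and then [t] in increasing order.  The first factor runs
    over all of [V] and not only over [t], so that it is a product over the
    omitted vertices of terms that do not depend on [t]. *)
Definition cycle_coef V t : R :=
  (\prod_(x in V :\: t) \prod_(y in V) lts y x) * cross_sign (V :\: t).

Lemma pair_sign_sqr x y : pair_sign x y * pair_sign x y = 1.
Proof. by rewrite /pair_sign; case: ifP => _; rewrite ?ltsign_sqr ?mulr1. Qed.

Lemma cross_sign_sqr C : cross_sign C * cross_sign C = 1.
Proof. by do 2!apply: prod_sqr1 => ? _; apply: pair_sign_sqr. Qed.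

Lemma cycle_coef_sqr V t : cycle_coef V t * cycle_coef V t = 1.
Proof.
rewrite /cycle_coef mulrACA cross_sign_sqr mulr1.
by do 2!apply: prod_sqr1 => ? _; apply: ltsign_sqr.
Qed.

(** Depends on [w] in [cross_signU1] only through its block, hence is the same
    for the old and the new omitted vertex of an exchange. *)
Definition level_sign (i : nat) C : R :=
  \prod_(y in C) (if (i < blk y)%N then -1 else 1).

Lemma cross_signU1 w C : w \notin C -> (forall y, y \in C -> blk y != blk w) ->
  cross_sign (w |: C) = cross_sign C * level_sign (blk w) C * \prod_(y in C) lts y w.
Proof.
move=> wC blkC; rewrite /cross_sign big_setU1 //= big_setU1 //=.
rewrite {1}/pair_sign ltnn mul1r.
under [X in _ * X]eq_bigr do rewrite big_setU1 //.
rewrite big_split /= mulrA -[RHS]mulrA [RHS]mulrC; congr (_ * _).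
rewrite /level_sign -!big_split /=; apply: eq_bigr => y yC; rewrite /pair_sign.
case: (ltngtP (blk w) (blk y)) (blkC y yC) => [lt _|lt _|//].
  rewrite mul1r mulN1r -(mulr1 (lts w y)) -(ltsign_sqr R y w) mulrA ltsignC ?mulN1r //.
  by apply: contraTneq wC => ->; rewrite yC.
by rewrite mulr1 mul1r.
Qed.

(** The listings of [V] for the two facets differ by the transposition of [u]
    and [w], once these are moved to the front of the facets; this gives the
    minus sign, and moving them gives the incidence signs. *)
Lemma cycle_coef_exchange V t u w : t \subset V -> u \in t -> w \in V :\: t ->
  blk u = blk w -> (forall y, y \in (V :\: t) :\ w -> blk y != blk w) ->
  exchange_sign R t u w * cycle_coef V (w |: (t :\ u)) = - cycle_coef V t.
Proof.
move=> tV ut wVt uw bC; have [wV wt] := setDP wVt; have uV := subsetP tV u ut.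
set C := (V :\: t) :\ w in bC.
have tC : V :\: t = w |: C by rewrite setD1K.
have neuw : u != w by apply: contraNneq wt => <-.
have sC : V :\: (w |: (t :\ u)) = u |: C.
  apply/setP => x; rewrite !inE; case: (eqVneq x w) => [->|_] /=.
    by rewrite eq_sym (negPf neuw).
  by case: (eqVneq x u) => //= ->.
have wC : w \notin C by rewrite !inE eqxx.
have uC : u \notin C by rewrite !inE ut andbF.
have key : cycle_coef V t * cycle_coef V (w |: (t :\ u)) = - exchange_sign R t u w.
  rewrite /cycle_coef tC sC !cross_signU1 ?uw // !big_setU1 //=.
  set P := \prod_(x in C) _; set G := cross_sign C; set L := level_sign _ _.
  have PP : P * P = 1 by do 2!apply: prod_sqr1 => ? _; apply: ltsign_sqr.
  have GG : G * G = 1 := cross_sign_sqr C.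
  have LL : L * L = 1 by apply: prod_sqr1 => y _; case: ifP => _; ring.
  have rE : V = w |: (u |: ((t :\ u) :|: C)).
    apply/setP => x; rewrite !inE; case: (eqVneq x w) => [->|_] //=.
    case: (eqVneq x u) => [->|_] //=.
    by case xt: (x \in t) => //=; rewrite (subsetP tV).
  have tuC : [disjoint t :\ u & C].
    by apply/pred0P => x /=; rewrite !inE; case: (x \in t); rewrite ?andbF.
  have VE (F : T -> R) : \prod_(x in V) F x =
      F w * (F u * ((\prod_(x in t :\ u) F x) * \prod_(x in C) F x)).
    rewrite rE big_setU1; last by rewrite !inE (negPf wt) eqxx eq_sym (negPf neuw) !andbF.
    rewrite big_setU1; last by rewrite !inE eqxx ut /= andbF.
    rewrite -bigU //=; congr (_ * (_ * _)).
    by apply: eq_bigl => x; rewrite !inE.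
  rewrite !VE exchange_signE // big_split /=.
  set a := \prod_(x in t :\ u) _; set b := \prod_(x in t :\ u) _.
  set e := \prod_(y in C) lts y w; set f := \prod_(y in C) lts y u.
  have ee : e * e = 1 by apply: prod_sqr1 => y _; apply: ltsign_sqr.
  have ff : f * f = 1 by apply: prod_sqr1 => y _; apply: ltsign_sqr.
  have := ltsignC R neuw; have := ltsign_sqr R u u; have := ltsign_sqr R w w.
  rewrite /ltsign !ltxx expr0.
  move: (_ ^+ _) (_ ^+ _) => x y _ _ xy.
  (* Apart from a * b and one pair u, w, every sign occurs twice. *)
  transitivity ((P * P) * (G * G) * (L * L) * (e * e) * (f * f) * (y * x) * (a * b)).
    by ring.
  by rewrite PP GG LL ee ff xy; ring.
rewrite -(mulr1 (cycle_coef V (_ |: _))) -(cycle_coef_sqr V t).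
rewrite [_ (w |: _) * _]mulrA [_ (w |: _) * _]mulrC key mulrA mulrN.
by rewrite exchange_sign_sqr // mulN1r.
Qed.

End BlockSign.
End Cycle.

Section BlockFacets.
Variables (T : finType) (Y B : {set {set T}}) (h k : nat).
Hypothesis cY : is_complex Y.
Hypothesis bY : block_structure Y B h k.
Implicit Types (s t M : {set T}).
Local Notation V := (vertices Y).

Let tB : trivIset B. Proof. by have [] := bY. Qed.

Lemma block_nonface s M : s \in Y -> M \in B -> ~~ (M \subset s).
Proof.
move=> sY; have [_ _ _ /(_ _ (sub_vertices sY))] := bY.
by rewrite sY => /esym/forall_inP; apply.
Qed.

Lemma card_facetC t : t \in faces Y k -> #|V :\: t| = #|B|.
Proof.
move=> tP; have [_ _ cB _] := bY.
by apply/eqP; rewrite -(eqn_add2r k.+1) cB card_codim.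
Qed.

Lemma facet_block t w : t \in faces Y k -> w \in V :\: t ->
  exists2 M : {set T}, M \in B & M :\: t = [set w].
Proof.
move=> tP wVt; apply: block_facet tB _ (card_facetC tP) wVt => M MB.
have [_ /(_ _ MB)[_ MV] _ _] := bY; split=> //; apply: block_nonface MB.
by case/setIdP: tP.
Qed.

Lemma facet_maximal t w : t \in faces Y k -> w \in V :\: t -> w |: t \notin Y.
Proof.
move=> tP wVt; have [M MB Mw] := facet_block tP wVt.
apply/negP => /block_nonface/(_ MB)/negP; apply; apply/subsetP => x xM.
by rewrite -Mw !inE xM andbT orNb.
Qed.

Lemma facet_deg t : t \in faces Y k -> deg Y t = 0%N.
Proof.
move=> tP; have /setIdP[tY _] := tP; rewrite degE //.
apply/eqP; rewrite cards_eq0; apply/eqP/setP => v; rewrite inE in_set0.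
by apply/negP => /andP[/(facet_maximal tP)/negP vY /vY].
Qed.

(** Removing a vertex of the completed block destroys the only block in
    [w |: t]. *)
Lemma facet_exch t w M : t \in faces Y k -> w \in V :\: t -> M \in B ->
  M :\: t = [set w] -> exch Y t w = M :\ w.
Proof.
move=> tP wVt MB Mw; have [_ _ _ YE] := bY.
have /setIdP[tY _] := tP; have [wV wt] := setDP wVt.
have wM : w \in M by have := set11 w; rewrite -Mw => /setDP[].
have Mwt : M \subset w |: t.
  by apply/subsetP => x xM; rewrite -Mw !inE xM andbT orNb.
have MY : M \notin Y by apply/negP => /block_nonface/(_ MB); rewrite subxx.
apply/eqP; rewrite eqEsubset exch_subD1 //=.
apply/subsetP => u /setD1P[uw uM].
have ut : u \in t by have := subsetP Mwt u uM; rewrite !inE (negPf uw).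
apply/exchP; split=> //; rewrite YE; last first.
  by rewrite subUset sub1set wV (subset_trans (subsetDl _ _)) ?sub_vertices.
apply/forall_inP => N NB; apply/negP => Ns.
have : ~~ (N \subset t) by apply: block_nonface.
case/subsetPn => x xN xt; have := subsetP Ns x xN.
rewrite !inE (negPf xt) andbF orbF => /eqP xw; rewrite xw in xN.
have NM : N = M by apply: (trivIset_eq tB NB MB xN wM).
have := subsetP Ns u; rewrite NM uM !inE eqxx (negPf uw) /=.
by move/(_ isT).
Qed.

Lemma card_facet_exch t w : t \in faces Y k -> w \in V :\: t -> #|exch Y t w| = h.
Proof.
move=> tP wVt; have [M MB Mw] := facet_block tP wVt.
have [_ /(_ _ MB)[cM _] _ _] := bY.
have wM : w \in M by have := set11 w; rewrite -Mw => /setDP[].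
by rewrite (facet_exch tP wVt MB Mw); move: cM; rewrite (cardsD1 w) wM => -[].
Qed.

End BlockFacets.

Section BlockEigenfunction.
Variables (R : realType) (d : Order.disp_t) (T : finOrderType d).
Variables (Y B : {set {set T}}) (h k : nat) (c : {set T} -> nat) (c0 : nat).
Hypothesis cY : is_complex Y.
Hypothesis bY : block_structure Y B h k.
Hypothesis cE : forall s, s \in faces Y k -> c s = c0.
Local Notation V := (vertices Y).

Definition block_index (x : T) : nat := enum_rank (pblock B x).

Lemma block_index_inj x y : block_index x = block_index y -> pblock B x = pblock B y.
Proof. by move/val_inj/enum_rank_inj. Qed.

(** Every facet has degree 0, and each of the [#|B|] omitted vertices gives
    [h] exchanges, all with the value [- phi t].  So the eigenvalue is
    [k + 1 - c0 - h * #|B|], and [#|B|] is [#|V| - k.+1]. *)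
Lemma block_eigenfunction :
  eigenfunction Y k c (cycle_coef R block_index V)
    ((h.+1 * k.+1)%:Z - (h * #|V|)%:Z - c0%:Z)%:~R.
Proof.
have [tB BV cB _] := bY.
move=> t tP; have /setIdP[tY _] := tP.
have bt : blocked Y t = V :\: t.
  apply/setP => v; rewrite inE; apply/andP/idP => [[]//|vV].
  by split=> //; apply: facet_maximal bY _ _ tP vV.
have -> : exchange_sum Y (cycle_coef R block_index V) t =
    \sum_(v in V :\: t) \sum_(u in exch Y t v) - cycle_coef R block_index V t.
  rewrite /exchange_sum bt; apply: eq_bigr => w wVt; apply: eq_bigr => u uE.
  have [M MB Mw] := facet_block bY tP wVt.
  have wM : w \in M by have := set11 w; rewrite -Mw => /setDP[].
  have /exchP[ut _] := uE; rewrite (facet_exch cY bY tP wVt MB Mw) in uE.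
  have /setD1P[uw uM] := uE.
  apply: cycle_coef_exchange => //; first exact: sub_vertices.
    by rewrite /block_index (def_pblock tB MB uM) (def_pblock tB MB wM).
  move=> y /setD1P[yw yVt]; have [N NB Ny] := facet_block bY tP yVt.
  have yN : y \in N by have := set11 y; rewrite -Ny => /setDP[].
  apply: contra yw => /eqP/block_index_inj.
  rewrite (def_pblock tB MB wM) (def_pblock tB NB yN) => NM.
  by rewrite -in_set1 -Mw -NM Ny set11.
under eq_bigr => v vV do rewrite sumr_const (card_facet_exch cY bY tP vV).
rewrite sumr_const (card_facetC bY tP) (facet_deg cY bY tP) cE //.
rewrite -cB -mulrnA.
rewrite !rmorphB /= -!pmulrn.
rewrite -mulr_natl.
ring.
Qed.

End BlockEigenfunction.

(** * Joins of simplex boundaries as block structures *)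

Section Joins.
Implicit Types (T U : finType).

Definition sphere_join (h m b : nat) : {set {set ('I_m * 'I_h.+1) + 'I_b}} :=
  join (join_power (skeleton (full_simplex h.+1) (h%:Z - 1)) m) (full_simplex b).

(** In the boundary of a simplex the faces are the sets that omit a vertex. *)
Lemma sphere_joinE h m b (s : {set ('I_m * 'I_h.+1) + 'I_b}) :
  (s \in sphere_join h m b) = [forall i, exists j, inl (i, j) \notin s].
Proof.
have skE (p : {set 'I_h.+1}) :
    (p \in skeleton (full_simplex h.+1) (h%:Z - 1)) = [exists j, j \notin p].
  rewrite !inE /Defs.dim; apply/idP/existsP => [le|[j jp]].
    apply/existsP; apply: contraT; rewrite negb_exists => /forallP all_p.
    have pT : p = setT by apply/setP => j; rewrite inE; have := all_p j; rewrite negbK.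
    by move: le; rewrite pT cardsT card_ord; lia.
  have : (#|p| < #|[set: 'I_h.+1]|)%N.
    by apply: proper_card; apply/properP; split; [apply: subsetT | exists j].
  by rewrite cardsT card_ord; lia.
apply/imset2P/forallP => [[_ q /imsetP[f /ffun_onP fP ->] _ -> i]|sP].
  have : f i \in skeleton (full_simplex h.+1) (h%:Z - 1) := fP i.
  rewrite skE => /existsP[j jf]; apply/existsP; exists j.
  rewrite inE negb_or; apply/andP; split; last by apply/imsetP => -[].
  apply: contra jf => /imsetP[[i' j'] + [-> ->]] => /bigcupP[i0 _].
  by case/imsetP => v vf [-> ->].
pose f := [ffun i : 'I_m => [set j | inl (i, j) \in s]].
exists (\bigcup_(i < m) [set (i, v) | v in f i]) [set l | inr l \in s]; rewrite ?inE //.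
  apply/imsetP; exists f => //; apply/ffun_onP => i; rewrite ffunE.
  apply: (etrans (skE _)).
  by have /existsP[j js] := sP i; apply/existsP; exists j; rewrite inE.
apply/setP => -[[i j]|l]; rewrite inE.
  apply/idP/orP => [js|[]].
  - left; apply/imsetP; exists (i, j) => //; apply/bigcupP; exists i => //.
    by apply/imsetP; exists j; rewrite // ffunE inE.
  - case/imsetP => -[i' j'] + [-> ->] => /bigcupP[i0 _] /imsetP[v + [-> ->]].
    by rewrite ffunE inE.
  by case/imsetP.
apply/idP/orP => [js|[]]; first by right; apply/imsetP; exists l; rewrite ?inE.
  by case/imsetP.
by case/imsetP => l'; rewrite inE => + [->].
Qed.

(** The boundary of a point has no vertices, hence the condition for [h = 0]. *)
Lemma sphere_join_vertices h m b :
  (h = 0 -> m = 0)%N -> vertices (sphere_join h m b) = setT.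
Proof.
move=> hm; apply/setP => u; rewrite inE; apply/bigcupP; exists [set u]; rewrite ?set11 //.
rewrite sphere_joinE; apply/forallP => i; apply/existsP.
have h0 : (0 < h)%N by case: h hm u => // hm _; have := ltn_ord i; rewrite {2}hm.
exists (if u == inl (i, ord0) then ord_max else ord0); rewrite inE.
case: (eqVneq u) => [->|]; last by rewrite eq_sym.
by apply/eqP => -[h00]; rewrite h00 in h0.
Qed.

Lemma card_isomorphic T U (X : {set {set T}}) (Y : {set {set U}}) :
  isomorphic X Y -> #|vertices X| = #|vertices Y|.
Proof.
case=> f [g [fK gK _ _]]; have := bij_eq_card (Bijective fK gK).
by rewrite !card_sig.
Qed.

End Joins.

Section BlockIsomorphism.
Variables (T : finType) (Y : {set {set T}}) (h k : nat).
Hypothesis cY : is_complex Y.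
Local Notation V := (vertices Y).
Local Notation b := ((h.+1 * k.+1)%:Z - (h * #|V|)%:Z).
Local Notation J := (sphere_join h (#|V| - k.+1) `|b|%N).

(** When [h] is 0 the join is a simplex with at most [k.+1] vertices, so there
    are no blocks and all points of the join are again vertices. *)
Lemma isomorphic_blocks : (k.+1 <= #|V|)%N -> 0 <= b -> isomorphic Y J ->
  exists B, block_structure Y B h k.
Proof.
move=> kV b0 iso; have cVJ := card_isomorphic iso.
have vJ : vertices J = setT.
  apply: sphere_join_vertices => h0; apply/eqP; rewrite subn_eq0 cVJ.
  have sub : vertices J \subset inr @: [set: 'I_`|b|].
    apply/subsetP => -[[i j]|l] /bigcupP[s sJ us]; last by rewrite imset_f.
    move: sJ; rewrite sphere_joinE => /forallP/(_ i)/existsP[j'].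
    rewrite (_ : j' = j) ?us //; apply: ord_inj.
    by have := ltn_ord j; have := ltn_ord j'; lia.
  apply: leq_trans (subset_leq_card sub) _.
  by rewrite card_imset ?cardsT ?card_ord; [lia | move=> ? ? []].
have [f [g [fK gK sf sg]]] := iso.
have uJ u : u \in vertices J by rewrite vJ.
pose G u := val (g (exist _ u (uJ u))).
have GV u : G u \in V := valP (g _).
have Ginj : injective G.
  move=> u v /val_inj/(can_inj gK) e; have := congr1 val e.
  by [].
have Gf x (xV : x \in V) : G (val (f (exist _ x xV))) = x.
  rewrite /G (_ : exist _ _ _ = f (exist _ x xV)) ?fK //.
  by apply: val_inj.
pose M i := [set G (inl (i, j)) | j : 'I_h.+1].
have MP i x : reflect (exists j, x = G (inl (i, j))) (x \in M i).
  by apply: (iffP imsetP) => [[j _ ->]|[j ->]]; exists j.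
have Mdis i i' x : x \in M i -> x \in M i' -> i = i'.
  by move=> /MP[j ->] /MP[j' /Ginj[]].
have Minj : injective M.
  move=> i i' e; have xM : G (inl (i, ord0)) \in M i by apply/MP; exists ord0.
  by apply: (Mdis _ _ _ xM); rewrite -e.
exists (M @: setT); split.
- apply/trivIsetP => _ _ /imsetP[i _ ->] /imsetP[i' _ ->] ne.
  apply/pred0P => x /=; apply/negP => /andP[xi xi'].
  by rewrite (Mdis _ _ _ xi xi') eqxx in ne.
- move=> _ /imsetP[i _ ->]; split.
    by rewrite card_imset ?card_ord // => j j' /Ginj[].
  by apply/subsetP => x /MP[j ->].
- by rewrite card_imset // cardsT card_ord subnK.
move=> s sV.
pose s' := [set x : {x | x \in V} | val x \in s].
have s'E : val @: s' = s.
  apply/setP => x; apply/imsetP/idP => [[y]|xs]; first by rewrite inE => + ->.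
  by exists (exist _ x (subsetP sV x xs)); rewrite ?inE.
pose r := [set val (f x) | x in s'].
have rE u : (u \in r) = (G u \in s).
  apply/imsetP/idP => [[[x xV]]|Gs]; rewrite ?inE /=.
    by move=> xs ->; rewrite Gf.
  exists (g (exist _ u (uJ u))); rewrite ?inE //=.
  by rewrite gK.
transitivity (r \in J).
  apply/idP/idP => [sY|rJ]; first by apply: sf; rewrite s'E.
  pose r' := [set u : {u | u \in vertices J} | val u \in r].
  have r'E : val @: r' = r.
    apply/setP => x; apply/imsetP/idP => [[y]|xs]; first by rewrite inE => + ->.
    by exists (exist _ x (uJ x)); rewrite ?inE.
  have := sg r'; rewrite r'E => /(_ rJ).
  rewrite (_ : [set _ | _ in _] = s) //.
  apply/setP => x; apply/imsetP/idP => [[[u uJ']]|xs].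
    rewrite inE /= rE => Gs ->; rewrite (_ : exist _ u uJ' = exist _ u (uJ u)) //.
    exact: val_inj.
  have xV := subsetP sV x xs.
  by exists (f (exist _ x xV)); rewrite ?fK // inE rE Gf.
rewrite sphere_joinE; apply/forallP/forall_inP => [rJ _ /imsetP[i _ ->]|sB i].
  have /existsP[j] := rJ i; rewrite rE; apply: contra => /subsetP; apply.
  by apply/MP; exists j.
have /subsetPn[_ /MP[j ->] js] : ~~ (M i \subset s) by apply: sB; rewrite imset_f.
by apply/existsP; exists j; rewrite rE.
Qed.

(** Enumerate the blocks, the vertices of each block and the remaining
    vertices.  Blocks of a single vertex do not occur, since a vertex is a
    face. *)
Lemma blocks_isomorphic B : block_structure Y B h k -> 0 <= b /\ isomorphic Y J.
Proof.
move=> bY; have [tB BV cB YE] := bY.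
have cBV : cover B \subset V by apply/bigcupsP => M /BV[].
have cc : #|cover B| = (#|B| * h.+1)%N.
  rewrite -(eqP tB) (eq_bigr (fun=> h.+1)) ?sum_nat_const // => M /BV[-> //].
have cU : (#|V :\: cover B| + #|B| * h.+1 = #|V|)%N.
  by rewrite -cc cardsDS // subnK // subset_leq_card.
have bE : b = #|V :\: cover B|%:Z by rewrite -cU in cB *; nia.
have mE : (#|V| - k.+1 = #|B|)%N by rewrite -cB addnK.
split; first by rewrite bE.
have vJ : vertices J = setT.
  apply: sphere_join_vertices => h0; rewrite mE; apply/eqP; rewrite cards_eq0.
  apply/eqP/setP => M; rewrite inE; apply/negP => MB; have [cM MV] := BV _ MB.
  have /cards1P[v vE] : #|M| == 1%N by rewrite cM h0.
  have vV : v \in V by rewrite (subsetP MV) // vE set11.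
  by case/negP: (block_nonface bY (vertex_face cY vV) MB); rewrite vE.
have [/eqP V0|/set0Pn[x0 _]] := boolP (V == set0).
  by move: cB; rewrite V0 cards0; lia.
pose M (i : 'I_(#|V| - k.+1)) := nth set0 (enum B) i.
have MB i : M i \in B.
  by rewrite -mem_enum mem_nth // -cardE -mE.
have Minj : injective M.
  move=> i i' /eqP; rewrite nth_uniq ?enum_uniq -?cardE -?mE // => /eqP.
  exact: ord_inj.
have Msurj N : N \in B -> exists i, M i = N.
  move=> NB; have iN : (index N (enum B) < #|V| - k.+1)%N.
    by rewrite mE cardE index_mem mem_enum.
  by exists (Ordinal iN); rewrite /M nth_index ?mem_enum.
pose g (u : ('I_(#|V| - k.+1) * 'I_h.+1) + 'I_`|b|) := match u with
  | inl (i, j) => nth x0 (enum (M i)) j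
  | inr l => nth x0 (enum (V :\: cover B)) l end.
have gM i j : g (inl (i, j)) \in M i.
  by rewrite /= -mem_enum mem_nth // -cardE; have [-> _] := BV _ (MB i).
have lR (l : 'I_`|b|) : (l < #|V :\: cover B|)%N by have := ltn_ord l; lia.
have gR l : g (inr l) \in V :\: cover B.
  by rewrite /= -mem_enum mem_nth // -cardE.
have MR i l j : g (inl (i, j)) <> g (inr l).
  have /setDP[_ ncov] := gR l; move=> e; case/negP: ncov; rewrite -e.
  by apply/bigcupP; exists (M i).
have ginj : injective g.
  case=> [[i j]|l] [[i' j']|l'] e.
  - have ii : i = i'.
      apply: Minj; apply: (trivIset_eq tB (MB i) (MB i') (gM i j)).
      by rewrite e.
    rewrite -ii in e *; congr (inl (i, _)); apply/ord_inj/eqP.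
    have [cM _] := BV _ (MB i).
    by rewrite -(nth_uniq x0 _ _ (enum_uniq (M i))) -?cardE ?cM //; apply/eqP.
  - by case: (MR _ _ _ e).
  - by case: (MR _ _ _ (esym e)).
  congr (inr _); apply/ord_inj/eqP.
  by rewrite -(nth_uniq x0 _ _ (enum_uniq (V :\: cover B))) -?cardE //; apply/eqP.
have gV u : g u \in V.
  case: u => [[i j]|l]; last by case/setDP: (gR l).
  by have [_ /subsetP MV] := BV _ (MB i); apply: MV.
have gJ s : (s \in J) = (g @: s \in Y).
  rewrite sphere_joinE YE; last by apply/subsetP => _ /imsetP[u _ ->].
  apply/forallP/forall_inP => [sJ _ /Msurj[i <-]|sB i].
    have /existsP[j js] := sJ i; apply: contra js => /subsetP/(_ _ (gM i j)).
    by rewrite mem_imset.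
  have /subsetPn[x xM xs] := sB _ (MB i); have [cM _] := BV _ (MB i).
  have jx : (index x (enum (M i)) < h.+1)%N by rewrite -cM cardE index_mem mem_enum.
  apply/existsP; exists (Ordinal jx); apply: contra xs => js.
  by apply/imsetP; exists (inl (i, Ordinal jx)); rewrite //= nth_index ?mem_enum.
pose g' (u : vertex J) : vertex Y := exist _ (g (val u)) (gV (val u)).
have g'inj : injective g'.
  by move=> u v e; apply: val_inj; apply: ginj; have := congr1 val e.
have [|f' gK fK] := inj_card_bij g'inj.
  rewrite /vertex !card_sig /= -[X in (X <= _)%N]/#|V|.
  rewrite -[X in (_ <= X)%N]/#|vertices J| vJ cardsT card_sum card_prod !card_ord.
  by rewrite mE; move: cU bE; lia.
have gim (s : {set {u | u \in vertices J}}) :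
    [set val (g' u) | u in s] = g @: (val @: s).
  by rewrite -imset_comp.
exists f', g'; split=> // s sY; last by rewrite gim -gJ.
rewrite gJ (_ : g @: _ = val @: s) // -imset_comp.
by apply: eq_imset => x; apply: (congr1 val (fK x)).
Qed.

End BlockIsomorphism.

(** * The relative Laplacian as an operator on the core *)

Section Core.
Variables (T : finType) (X A : {set {set T}}) (k : nat).
Hypotheses (cX : is_complex X) (bA : discrete_boundary X A k).
Implicit Types (s t r : {set T}).
Local Notation Y := (core X A k).

Lemma in_rel_facesE s :
  (s \in rel_faces X A k) = [&& s \in X, s \notin A & #|s| == k.+1].
Proof.
rewrite inE !in_facesE; case: (s \in X) => /=; last by rewrite andbF.
by case: (#|s| == k.+1); rewrite ?andbT ?andbF.
Qed.

(** Two distinct faces through [r] would give it degree at least 2. *)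
Lemma boundary_notin_pair r s t : r \in A -> #|r| = k ->
  s \in X -> #|s| = k.+1 -> t \in X -> #|t| = k.+1 ->
  r \subset s -> r \subset t -> s = t.
Proof.
move=> rA rk sX sk tX tk rs rt; apply/eqP; apply: contraT => st.
have [_ _ /(_ r)] := bA; rewrite in_faces_predE rA rk eqxx => /(_ isT).
rewrite leqNgt => /negP[]; rewrite /deg.
have sub : [set s; t] \subset [set x in faces X (Defs.dim r + 1) | r \subset x].
  apply/subsetP => x /set2P[] ->; rewrite !inE /Defs.dim ?sX ?tX ?rs ?rt;
    rewrite ?rk ?sk ?tk /=; by apply/andP; split=> //; apply/eqP; lia.
by apply: leq_trans (subset_leq_card sub); rewrite cards2 st.
Qed.

(** Such an [s] in [A] has a face [s :\ u] in [A], which lies both in [s] and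
    in [w |: (s :\ u)] for a vertex [w] of [t] outside [s]. *)
Lemma large_face_notin t s : t \in X -> (k.+1 < #|t|)%N -> s \subset t ->
  #|s| = k.+1 -> s \notin A.
Proof.
move=> tX tk st sk; apply/negP => sA; have [_ dX] := cX.
have [u us] : exists u, u \in s by apply/card_gt0P; rewrite sk.
have /subsetPn[w wt ws] : ~~ (t \subset s).
  by apply/negP => /subset_leq_card; rewrite sk; lia.
have rk : #|s :\ u| = k by move: sk; rewrite (cardsD1 u) us => -[].
have rA : s :\ u \in A.
  by have [_ [[_ dA] _] _] := bA; apply: dA sA _; apply: subsetDl.
have wr : w \notin s :\ u by rewrite !inE negb_and ws orbT.
have e : s = w |: (s :\ u).
  apply: (boundary_notin_pair rA rk _ sk); rewrite ?subsetDl ?subsetUr //.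
  - exact: dX tX st.
  - by apply: dX tX _; rewrite subUset sub1set wt (subset_trans _ st) ?subsetDl.
  - by rewrite cardsU1 wr rk.
by move: ws; rewrite e setU11.
Qed.

Lemma coreP s : reflect (exists t, [/\ s \subset t, t \in X &
    (t \in rel_faces X A k) || (k.+1 < #|t|)%N]) (s \in Y).
Proof.
rewrite inE; apply: (iffP existsP) => -[t].
  case/andP => /orP[tr|/andP[tX tk]] st; exists t; split=> //.
  - by move: tr; rewrite in_rel_facesE => /and3P[].
  - by rewrite tr.
  by apply/orP; right; move: tk; rewrite /Defs.dim; lia.
case=> st tX tk; exists t; rewrite st andbT tX /=.
by case/orP: tk => [->//|tk]; apply/orP; right; rewrite /Defs.dim; lia.
Qed.

Lemma core_sub s : s \in Y -> s \in X.
Proof. by case/coreP => t [st tX _]; case: cX => _ dX; apply: dX tX st. Qed.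

Lemma core_subcomplex : rel_faces X A k != set0 -> subcomplex Y X.
Proof.
move=> ne.
split; last by apply/subsetP => s; apply: core_sub.
split=> [|s t /coreP[t' [tt' t'X t'k]] st]; last first.
  by apply/coreP; exists t'; rewrite (subset_trans st).
have [t tP] := set0Pn _ ne; apply/coreP; exists t; rewrite sub0set tP; split=> //.
by move: tP; rewrite in_rel_facesE => /and3P[].
Qed.

Lemma core_large s : (k.+1 < #|s|)%N -> (s \in Y) = (s \in X).
Proof.
move=> sk; apply/idP/idP => [|sX]; first exact: core_sub.
by apply/coreP; exists s; rewrite sk orbT.
Qed.

Lemma core_faces : faces Y k = rel_faces X A k.
Proof.
apply/setP => s; rewrite in_facesE in_rel_facesE andbA.
case: eqP => [sk|]; rewrite ?andbF // !andbT.
apply/idP/andP => [sY|[sX sA]]; last first.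
  by apply/coreP; exists s; rewrite in_rel_facesE sX sA sk eqxx.
split; first exact: core_sub.
have /coreP[t [st tX /orP[]]] := sY; last by move=> tk; apply: large_face_notin st sk.
rewrite in_rel_facesE => /and3P[_ tA /eqP tk].
by rewrite (_ : s = t) //; apply/eqP; rewrite eqEcard st sk tk leqnn.
Qed.

End Core.

Section Laplacian.
Variables (R : realType) (d : Order.disp_t) (T : finOrderType d).
Variables (X A : {set {set T}}) (k : nat).
Hypotheses (cX : is_complex X) (bA : discrete_boundary X A k).
Implicit Types (s t r : {set T}).
Local Notation Y := (core X A k).
Local Notation P := (rel_faces X A k).
Local Notation bc := (boundary_coef R).
Local Notation c s := #|subfaces X s (k%:Z - 1) :&: faces A (k%:Z - 1)|.

Definition laplacian_coef s t : R :=
  \sum_(e in rel_faces X A (k%:Z + 1)) bc e s * bc e t +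
  \sum_(r in rel_faces X A (k%:Z - 1)) bc s r * bc t r.

Lemma rel_laplacianE i j :
  rel_laplacian R X A k i j = laplacian_coef (enum_val i) (enum_val j).
Proof.
rewrite !mxE /laplacian_coef; congr (_ + _).
  rewrite [RHS]big_enum_val /=; apply: eq_bigr => e _; rewrite !mxE //.
by rewrite [RHS]big_enum_val /=; apply: eq_bigr => e _; rewrite !mxE.
Qed.

Let YP s : s \in P -> [/\ s \in X, s \notin A, #|s| = k.+1 & s \in Y].
Proof.
move=> sP; have := sP; rewrite -(core_faces cX bA) in_facesE => /andP[sY _].
by move: sP; rewrite in_rel_facesE => /and3P[? ? /eqP].
Qed.

Let in_up (e s : {set T}) : s \in P -> s \subset e ->
  (e \in rel_faces X A (k%:Z + 1)) = (e \in X) && (#|e| == k.+2).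
Proof.
move=> /YP[_ sA _ _] se; rewrite inE !in_faces_succE.
have -> : (e \in A) = false; last by [].
by apply: contraNF sA => eA; have [_ [[_ dA] _] _] := bA; apply: dA eA se.
Qed.

Lemma in_rel_faces_predE r :
  (r \in rel_faces X A (k%:Z - 1)) = [&& r \in X, r \notin A & #|r| == k].
Proof.
rewrite inE !in_faces_predE; case: (r \in X) => /=; last by rewrite andbF.
by case: (#|r| == k); rewrite ?andbT ?andbF.
Qed.

Lemma laplacian_coef_diag t : t \in P ->
  laplacian_coef t t = (deg Y t)%:R + k.+1%:R - (c t)%:R.
Proof.
move=> tP; have [tX tA tk tY] := YP tP; have [_ dX] := cX.
have sqr (e s : {set T}) : #|e| = #|s|.+1 -> s \subset e -> bc e s * bc e s = 1.
  move=> es se; have /cards1P[v vE] : #|e :\: s| == 1%N by rewrite cardsDS // es subSnn.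
  have ve : v \in e :\: s by rewrite vE set11.
  have -> : e = v |: s by rewrite -vE setUC -{1}(setIidPr se) setID.
  by apply: boundary_coef_sqr; case/setDP: ve.
rewrite /laplacian_coef -addrA; congr (_ + _).
  rewrite (bigID (fun e : {set T} => t \subset e)) /=
    [X in _ + X]big1 => [|e /andP[_ te]]; last first.
    by rewrite boundary_coef0 ?mul0r.
  rewrite addr0 (eq_bigr (fun=> 1)) => [|e /andP[eP te]]; last first.
    by apply: sqr => //; move: eP; rewrite (in_up tP te) tk => /andP[_ /eqP].
  rewrite sumr_const; congr (_%:R); apply: eq_card => e.
  rewrite unfold_in /= [RHS]in_set [X in _ = X && _]in_set.
  case te: (t \subset e); rewrite ?andbF // !andbT (in_up tP te).
  rewrite /Defs.dim tk; case: (eqVneq #|e| k.+2) => ek.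
    rewrite core_large ?ek // !andbT.
    by rewrite (_ : _ == _ = true) ?andbT //; apply/eqP; lia.
  rewrite !andbF; symmetry; apply/negbTE; rewrite negb_and.
  by apply/orP; right; apply/eqP; lia.
rewrite (bigID (fun r : {set T} => r \subset t)) /=
    [X in _ + X]big1 => [|e /andP[_ te]]; last first.
  by rewrite boundary_coef0 ?mul0r.
rewrite addr0 (eq_bigr (fun=> 1)) => [|r /andP[rP rt]]; last first.
  by apply: sqr => //; move: rP; rewrite in_rel_faces_predE tk => /and3P[_ _ /eqP->].
rewrite sumr_const; apply/eqP; rewrite eq_sym subr_eq -natrD eqr_nat eq_sym; apply/eqP.
have <- : #|[set r : {set T} | r \subset t & #|r| == k]| = k.+1.
  rewrite cards_draws tk binSn //.
rewrite -[RHS](cardsID A) addnC; congr (_ + _)%N; apply: eq_card => r.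
  rewrite !in_setI [X in X && _ = _]in_set [X in _ = X && _]in_set !in_faces_predE.
  case rt: (r \subset t); rewrite ?andbF //= ?andbT (dX _ _ tX rt) /=.
  by case: (#|r| == k); rewrite ?andbF ?andbT.
rewrite !inE unfold_in /= in_rel_faces_predE.
case rt: (r \subset t); rewrite ?andbF // (dX _ _ tX rt) /= andbT andbC.
by rewrite andbC.
Qed.

Lemma laplacian_coef_neq0 s t : s \in P -> t \in P -> s != t ->
  laplacian_coef s t != 0 ->
  exists v u, [/\ v \notin t, u \in t & s = v |: (t :\ u)].
Proof.
move=> sP tP st nz; have [_ _ sk _] := YP sP; have [_ _ tk _] := YP tP.
suff: exists r u v, [/\ u \notin r, v \notin r, s = v |: r & t = u |: r].
  case=> r [u [v [ur vr sE tE]]]; exists v, u; rewrite tE setU1K // setU11; split=> //.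
  rewrite in_setU1 (negPf vr) orbF; apply: contraNneq st => uv.
  by rewrite sE tE uv.
have [/existsP[r /andP[]]|no] := boolP [exists r, (bc s r != 0) && (bc t r != 0)].
  by move=> /boundary_coef_neq0[v vr ->] /boundary_coef_neq0[u ur ->]; exists r, u, v.
have [/existsP[e /andP[]]|no'] := boolP [exists e, (bc e s != 0) && (bc e t != 0)].
  move=> /boundary_coef_neq0[u us eE] /boundary_coef_neq0[v vt eE'].
  have neuv : u != v.
    apply: contraNneq st => uv; apply/eqP.
    by rewrite -(setU1K us) -(setU1K vt) -eE uv -eE'.
  exists (e :\ u :\ v), u, v; rewrite !inE !eqxx ?andbF; split=> //.
  - rewrite setD1K; first by rewrite eE setU1K.
    by rewrite !inE eq_sym neuv eE' setU11.
  have -> : e :\ u :\ v = e :\ v :\ u by apply/setP => x; rewrite !inE andbCA.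
  rewrite setD1K; first by rewrite eE' setU1K.
  by rewrite !inE neuv eE setU11.
case/eqP: nz; rewrite /laplacian_coef !big1 ?addr0 // => x _.
  move: no; rewrite negb_exists => /forallP/(_ x); rewrite negb_and !negbK.
  by case/orP => /eqP->; rewrite ?mul0r ?mulr0.
move: no'; rewrite negb_exists => /forallP/(_ x); rewrite negb_and !negbK.
by case/orP => /eqP->; rewrite ?mul0r ?mulr0.
Qed.

(** The common face [t :\ u] is never in [A], so the down part is always
    present; the up part cancels it exactly when [v |: t] is a face. *)
Lemma laplacian_coef_swap t u v : t \in P -> u \in t -> v \notin t ->
  v |: (t :\ u) \in P ->
  laplacian_coef (v |: (t :\ u)) t =
    if v |: t \in Y then 0 else exchange_sign R t u v.
Proof.
move=> tP ut vt sP; have [tX tA tk tY] := YP tP; have [sX sA sk sY] := YP sP.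
have [_ dX] := cX.
set s := v |: (t :\ u) in sP sX sA sk sY *; set r := t :\ u.
have vr : v \notin r by rewrite !inE negb_and vt orbT.
have ur : u \notin r by rewrite !inE eqxx.
have neuv : u != v by apply: contraNneq vt => <-.
have rk : #|r| = k by move: tk; rewrite (cardsD1 u) ut => -[].
have rA : r \notin A.
  apply/negP => rA; move: vt; rewrite -(_ : s = t) ?setU11 //.
  by apply: (boundary_notin_pair bA rA rk); rewrite ?subsetDl ?subsetUr.
have rX : r \in X by apply: dX tX _; apply: subsetDl.
have vtk : #|v |: t| = k.+2 by rewrite cardsU1 vt tk.
have upE e : e \in rel_faces X A (k%:Z + 1) -> e != v |: t -> bc e s * bc e t = 0.
  move=> eP; apply: contraNeq; rewrite mulf_eq0 negb_or => /andP[es et].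
  have se : s \subset e by have [x _ ->] := boundary_coef_neq0 es; apply: subsetUr.
  have te : t \subset e by have [x _ ->] := boundary_coef_neq0 et; apply: subsetUr.
  have ek : #|e| = k.+2.
    by have [x xt ->] := boundary_coef_neq0 et; rewrite cardsU1 xt tk.
  by rewrite eq_sym eqEcard vtk ek leqnn subUset te sub1set (subsetP se) ?setU11.
have down : \sum_(r in rel_faces X A (k%:Z - 1)) bc s r * bc t r = exchange_sign R t u v.
  rewrite (bigD1 r) /=; last by rewrite in_rel_faces_predE rX rA rk eqxx.
  rewrite big1 ?addr0 => [|q /andP[]]; first by rewrite /exchange_sign mulrC.
  rewrite in_rel_faces_predE => /and3P[_ _ /eqP qk]; apply: contraNeq.
  rewrite mulf_eq0 negb_or => /andP[sq tq].
  have [x xq sE] := boundary_coef_neq0 sq; have [y yq tE] := boundary_coef_neq0 tq.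
  rewrite eqEcard rk qk leqnn andbT; apply/subsetP => z zq.
  have zt : z \in t by rewrite tE inE zq orbT.
  have : z \in s by rewrite sE inE zq orbT.
  by rewrite in_setU1; case: eqP => [zv|//]; rewrite zv (negPf vt) in zt.
rewrite /laplacian_coef down core_large ?vtk //; case: ifPn => vtX.
  rewrite (bigD1 (v |: t)) /=; last by rewrite (in_up tP (subsetUr _ _)) vtX vtk eqxx.
  rewrite big1 ?addr0 => [|e /andP[eP en]]; last exact: upE.
  have := boundary_coef_square R ur vr neuv; rewrite (setD1K ut) -/s.
  have -> : u |: s = v |: t by rewrite /s setUCA setD1K.
  by rewrite /exchange_sign -/r -/s => E; rewrite mulrC E addNr.
rewrite big1 ?add0r // => e eP; apply: upE => //.
apply: contraNneq vtX => <-; move: eP; rewrite in_setD => /andP[_].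
by rewrite in_faces_succE => /andP[].
Qed.

(** The left side is an entry of a row vector times the Laplacian; the right side
    is the operator whose eigenfunctions the Gershgorin estimate treats. *)
Lemma laplacian_action phi t : t \in P ->
  \sum_(s in P) phi s * laplacian_coef s t =
  ((deg Y t)%:R + k.+1%:R - (c t)%:R) * phi t + exchange_sum Y phi t.
Proof.
move=> tP; have [tX tA tk tY] := YP tP; have PE := core_faces cX bA.
rewrite (bigD1 t) //= laplacian_coef_diag // mulrC; congr (_ + _).
pose Q := [set p | (p.1 \in blocked Y t) && (p.2 \in exch Y t p.1)].
pose swap (p : T * T) := p.1 |: (t :\ p.2).
have QP p : p \in Q -> [/\ p.1 \notin t, p.2 \in t, swap p \in P & p.1 |: t \notin Y].
  rewrite inE => /andP[pb pe]; have /setIdP[/setDP[_ p1] pY] := pb.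
  have /exchP[p2 _] := pe; split=> //.
  by rewrite -PE; apply: exch_face pe; rewrite ?PE.
have swap_inj : {in Q &, injective swap}.
  move=> [v u] [v' u'] /QP[/= vt ut _ _] /QP[/= _ _ _ _] e.
  have vv : v = v'.
    have : v \in swap (v', u') by rewrite -e setU11.
    by rewrite in_setU1 in_setD1 (negPf vt) andbF orbF => /eqP.
  have uu : u = u'.
    apply/eqP; apply: contraT => ne.
    have : u \in swap (v', u') by rewrite in_setU1 in_setD1 ne ut orbT.
    rewrite -e in_setU1 in_setD1 eqxx orbF => /eqP /= uv.
    by rewrite -uv ut in vt.
  by rewrite vv uu.
rewrite /exchange_sum pair_big_dep /=.
transitivity (\sum_(p in Q) phi (swap p) * laplacian_coef (swap p) t); last first.
  rewrite [RHS](eq_bigl (mem Q)) => [|p]; last by rewrite -[RHS]/(p \in Q) [RHS]in_set.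
  apply: eq_bigr => p /QP[vt ut sP vY].
  by rewrite laplacian_coef_swap // (negPf vY) mulrC.
rewrite -[RHS](big_imset (fun s => phi s * laplacian_coef s t) swap_inj) /=.
rewrite (bigID (mem (swap @: Q))) /= [X in _ + X]big1 ?addr0 => [|s]; last first.
  case/andP => /andP[sP st]; apply: contraNeq; rewrite mulf_eq0 negb_or => /andP[_ nz].
  have [v [u [vt ut sE]]] := laplacian_coef_neq0 sP tP st nz.
  move: nz sP; rewrite sE => nz sP; rewrite laplacian_coef_swap // in nz.
  have vY : v |: t \notin Y by apply: contraNN nz => ->.
  apply/imsetP; exists (v, u) => //; have [_ _ _ sY] := YP sP.
  rewrite in_set; apply/andP; split; last by apply/exchP.
  by rewrite in_set in_setD vt vY (subsetP (sub_vertices sY)) ?setU11.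
apply: eq_bigl => s; apply/andP/idP => [[]//|sQ]; split=> //.
have /imsetP[p /QP[vt ut sP _] ->] := sQ; rewrite sP /=.
by apply: contraNneq vt => <-; rewrite setU11.
Qed.

End Laplacian.

(** * Eigenvalues and eigenfunctions *)

Section Eigenvalues.
Variables (R : realType) (d : Order.disp_t) (T : finOrderType d).
Variables (X A : {set {set T}}) (k : nat).
Hypotheses (cX : is_complex X) (bA : discrete_boundary X A k).
Local Notation Y := (core X A k).
Local Notation L := (rel_laplacian R X A k).
Local Notation c := (fun s => #|subfaces X s (k%:Z - 1) :&: faces A (k%:Z - 1)|).

Lemma mulmx_rel_laplacian (v : 'rV[R]_#|rel_faces X A k|) phi j :
  (forall i, v 0 i = phi (enum_val i)) ->
  (v *m L) 0 j =
  ((deg Y (enum_val j))%:R + k.+1%:R - (c (enum_val j))%:R) * phi (enum_val j)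
    + exchange_sum Y phi (enum_val j).
Proof.
move=> vE; rewrite -(laplacian_action cX bA) ?enum_valP //.
rewrite mxE [RHS]big_enum_val; apply: eq_bigr => i _.
by rewrite vE rel_laplacianE.
Qed.

Lemma eigenvalue_eigenfunction a : eigenvalue L a ->
  exists phi, eigenfunction Y k c phi a /\ exists2 s, s \in faces Y k & phi s != 0.
Proof.
case/eigenvalueP => v vL /rV0Pn[i0 vi0].
have s0P := enum_valP i0.
(* Outside the basis the value is that of an arbitrary basis face; only the
   k-faces of the core occur in the eigenvalue equation. *)
pose phi s := v 0 (enum_rank_in s0P s).
have vE i : v 0 i = phi (enum_val i) by rewrite /phi enum_valK_in.
exists phi; rewrite (core_faces cX bA); split; last first.
  by exists (enum_val i0) => //; rewrite -vE.
move=> t; rewrite (core_faces cX bA) => tP.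
have := congr1 (fun w : 'rV_ _ => w 0 (enum_rank_in s0P t)) vL.
by rewrite /= (mulmx_rel_laplacian _ vE) mxE !enum_rankK_in.
Qed.

Lemma eigenfunction_eigenvalue phi a s : eigenfunction Y k c phi a ->
  s \in faces Y k -> phi s != 0 -> eigenvalue L a.
Proof.
move=> ev; rewrite (core_faces cX bA) => sP s0.
pose v : 'rV[R]_#|rel_faces X A k| := \row_i phi (enum_val i).
have vE i : v 0 i = phi (enum_val i) by rewrite mxE.
apply/eigenvalueP; exists v; last first.
  by apply/rV0Pn; exists (enum_rank_in sP s); rewrite vE enum_rankK_in.
apply/rowP => j; rewrite (mulmx_rel_laplacian _ vE) mxE vE.
by apply: ev; rewrite (core_faces cX bA) enum_valP.
Qed.

End Eigenvalues.

Theorem theorem1p8 (R : realType) (d : Order.disp_t) (T : finOrderType d)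
    (X A : {set {set T}}) (k : nat)
    (hX : is_complex X) (hk : (1 <= k)%N)
    (hA : discrete_boundary X A k)
    (hne : rel_faces X A k != set0) :
  let X' := core X A k in
  let h := hdim X' in
  let n := #|vertices X'| in
  let c (s : {set T}) := #|subfaces X s (k%:Z - 1) :&: faces A (k%:Z - 1)| in
  let m := min_over (faces X' k) (fun s => (h.+1 * deg X' s)%:Z - (c s)%:Z) in
  let b : int := (h.+1 * k.+1)%:Z - (h * n)%:Z in
  let cmax := \max_(s in faces X' k) c s in
  [/\ subcomplex X' X,
      (m + b)%:~R <= mu R X A k,
      b - cmax%:Z <= m + b
    & mu R X A k = (b - cmax%:Z)%:~R <->
      [/\ 0 <= b,
          isomorphic X'
            (join
               (join_power (skeleton (full_simplex h.+1) (h%:Z - 1))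
                  (n - k.+1))
               (full_simplex `|b|%N))
        & exists c0 : nat, forall s, s \in faces X' k -> c s = c0]].
Proof.
move=> X' h n c m b cmax.
have sX : subcomplex X' X := core_subcomplex hX hne.
have cX' : is_complex X' by case: sX.
have [muE mu_min] := muP R hne.
have [phi [ev [s sP s0]]] := eigenvalue_eigenfunction hX hA muE.
have [t dt t0] := exists_dominant sP s0; have [tP _] := dt.
have cmaxP q : q \in faces X' k -> (c q <= cmax)%N.
  by move=> qP; exact: (@bigop.leq_bigmax_cond _ (mem (faces X' k)) c q qP).
have bound : b - cmax%:Z <= m + b.
  rewrite addrC lerD2r /m.
  have [q qP ->] := min_over_attained (fun s => (h.+1 * deg X' s)%:Z - (c s)%:Z) sP.
  by have := cmaxP q qP; lia.
split=> //.
  apply: le_trans (degree_bound cX' ev dt t0); rewrite ler_int lerD2r.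
  exact: min_over_leq.
split=> [muEb|[b0 iso [c0 c0P]]].
  have [bs cE] := equality_blocks cX' ev cmaxP muEb dt t0.
  have [b0 iso] := blocks_isomorphic cX' bs.
  by split=> //; exists cmax.
have kn : (k.+1 <= n)%N by have := card_codim tP; rewrite -/n; lia.
have [B bs] := isomorphic_blocks kn b0 iso.
have c0E : cmax = c0.
  apply/eqP; rewrite eqn_leq -{2}(c0P t tP) cmaxP // andbT.
  by apply/bigmax_leqP => q /c0P ->.
apply/le_anti/andP; split.
  apply: mu_min; rewrite c0E.
  have cyc : eigenfunction X' k c (cycle_coef R (block_index B) (vertices X'))
      (b - c0%:Z)%:~R by apply: block_eigenfunction.
  apply: (eigenfunction_eigenvalue hX hA cyc tP).
  apply: contra_eq_neq (cycle_coef_sqr R (block_index B) (vertices X') t) => ->.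
  by rewrite mulr0 eq_sym oner_eq0.
apply: le_trans (degree_bound cX' ev dt t0).
rewrite ler_int addrC lerD2r -[X in X <= _]add0r.
by apply: lerB => //; apply: cmaxP.
Qed.
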